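(* Let $\tau(t)=h+\eta(t)$ with $|\eta(t)|\le\mu\le h$, $\mu>0$, be a delay of case C, i.e. $\tau$ is a differentiable almost everywhere function satisfying $$\dot\tau(t)=\dot\eta(t)\le 1+p,\qquad p\ge 0 .$$ Let $$\mathcal F(p)=\begin{cases}\dfrac{2p+1}{p+1}, & 0\le p<1,\\[2mm] \dfrac{7p-1}{4p}, & p\ge 1.\end{cases}$$ Then for all $y\in L_2[0,\infty)$ with $y(t)=0$ for all $t\le 0$, and for $$u(t)=-\frac{1}{\mu\sqrt{\mathcal F(p)}}\int_{-h-\eta(t)}^{-h}y(t+s)\,ds,$$ the inequality $$\|u\|_{L_2}^2\le\|y\|_{L_2}^2$$ holds.
   Context: $L_2=L_2[0,\infty)$ is the space of square integrable functions $v:[0,\infty)\to\mathbb C^n$ with norm $\|v\|_{L_2}=\left[\int_0^\infty\|v(t)\|^2dt\right]^{1/2}$, where $\|\cdot\|$ is the Euclidean norm. The constant $h$ is the known nominal delay value, $\mu$ is a known upper bound on the delay uncertainty $\eta(t)$, and $1+p$ is the upper bound on the delay derivative.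
   Formalization: The delay τ is also assumed absolutely continuous from above on each [0,T] (downward jumps allowed); with only differentiability almost everywhere, an upward jump of η from −μ to μ with p=0 makes the inequality fail. *)

(* Defs.v *)
From HB Require Import structures.
From mathcomp Require Import all_boot all_order all_algebra.
From mathcomp Require Import complex.
From mathcomp Require Import all_classical all_reals all_analysis.

Set Implicit Arguments.
Unset Strict Implicit.
Unset Printing Implicit Defensive.

Import Order.TTheory GRing.Theory Num.Theory.
Import numFieldNormedType.Exports.

Local Open Scope classical_set_scope.
Local Open Scope ring_scope.
Local Open Scope complex_scope.

Definition euclid_norm (R : realType) (n : nat) (v : 'cV[R[i]]_n) : R :=
  Num.sqrt (\sum_(k < n) ComplexField.Normc.normc (v k 0) ^+ 2).

(* [+oo] when [v] is not square integrable. *)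
Definition L2norm (R : realType) (n : nat) (v : R -> 'cV[R[i]]_n) : \bar R :=
  ((\int[@lebesgue_measure R]_(t in `[0%R, +oo[)
      (euclid_norm (v t) ^+ 2)%:E) `^ (1 / 2))%E.

(* Each class modulo a.e. equality of Lebesgue measurable functions has a Borel
   measurable representative, so Borel measurability loses nothing. *)
Definition in_L2 (R : realType) (n : nat) (v : R -> 'cV[R[i]]_n) : Prop :=
  (forall k : 'I_n,
     measurable_fun (`[0, +oo[ : set R) (fun t => complex.Re (v t k 0)) /\
     measurable_fun (`[0, +oo[ : set R) (fun t => complex.Im (v t k 0))) /\
  (L2norm v < +oo)%E.

(* Integral from [a] to [b] with the usual sign convention when [b < a]. *)
Definition oriented_int (R : realType) (a b : R) (f : R -> R) : R :=
  if a <= b then \int[@lebesgue_measure R]_(s in `[a, b]) f s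
  else - \int[@lebesgue_measure R]_(s in `[b, a]) f s.

Definition oriented_vint (R : realType) (n : nat) (a b : R)
    (v : R -> 'cV[R[i]]_n) : 'cV[R[i]]_n :=
  \col_(k < n) (oriented_int a b (fun s => complex.Re (v s k 0)) +i*
                oriented_int a b (fun s => complex.Im (v s k 0))).

(* One-sided absolute continuity: the defining condition of absolute continuity,
   imposed on the increments [f (b i) - f (a i)] instead of their absolute
   values.  Every absolutely continuous function satisfies it, and so does a
   piecewise absolutely continuous function whose jumps are all downward. *)
Definition upper_abs_continuous (R : realType) (c d : R) (f : R -> R) : Prop :=
  forall eps : R, 0 < eps -> exists2 delta : R, 0 < delta &
  forall (m : nat) (a b : nat -> R),
    (forall i, (i < m)%N -> c <= a i /\ a i <= b i /\ b i <= d) ->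
    (forall i j, (i < j)%N -> (j < m)%N -> b i <= a j) ->
    \sum_(i < m) (b i - a i) < delta ->
    \sum_(i < m) (f (b i) - f (a i)) < eps.

(* Almost everywhere differentiability alone lets the delay grow on a null set
   (upward jumps, Cantor-type growth), which the derivative does not see and for
   which the bound on the operator norm fails; the first condition excludes
   exactly this.  Downward jumps, as in sampled-data (sawtooth) delays, remain
   allowed. *)
Definition delay_caseC (R : realType) (p : R) (tau : R -> R) : Prop :=
  [/\ forall T : R, 0 < T -> upper_abs_continuous 0 T tau,
      {ae @lebesgue_measure R, forall t, 0 <= t -> derivable tau t 1} &
      {ae @lebesgue_measure R, forall t, 0 <= t -> derive1 tau t <= 1 + p}].

Definition calF (R : realType) (p : R) : R :=
  if p < 1 then (2 * p + 1) / (p + 1) else (7 * p - 1) / (4 * p).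

Definition u_of (R : realType) (n : nat) (h mu p : R) (eta : R -> R)
    (y : R -> 'cV[R[i]]_n) (t : R) : 'cV[R[i]]_n :=
  (- (1 / (mu * Num.sqrt (calF p))))%:C *:
    oriented_vint (- h - eta t) (- h) (fun s => y (t + s)).

(* Main.v *)
(* Put [x = t - h] and [g x = eta (x + h)]. The integral defining [u t] runs over the
   window [I x] between [x] and [x - g x], and absolute continuity from above turns the
   bound on the derivative of the delay into [g b - g a <= (1 + p) * (b - a)] for
   [a <= b]. Let [A s] be the set of [x] with [s] in [I x].
   For [p < 1], Cauchy-Schwarz on [I x] and Tonelli leave the bound
   [int_(A s) |g| <= mu^2 (2p+1)/(p+1)].
   For [p >= 1], Cauchy-Schwarz is used with the weight [|A s|] instead, and what is left
   is [int_(I x) |A s| ds = int |I x `&` I t| dt <= mu^2 (7p-1)/(4p)]. Here the windows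
   with [t] outside [I x] contribute at most [2 c mu - c^2], [c = |g x|], whatever [g]
   is. Inside [I x] the delay would have to jump upwards for the overlap to be maximal;
   rearranging the sets [g < 0] and [g >= 0] into two adjacent intervals shows that
   the slope bound costs at least [c^2 / (4p)]. *)

(* The delay may drop by jumps and its growth is bounded only from above, so [x - g x] is in general
   neither monotone nor continuous, and [A s] need not be an interval. A change of variables along
   the delay is therefore replaced by Tonelli for the indicator of the windows and by comparing
   areas. The two constants [(2p+1)/(p+1)] and [(7p-1)/(4p)] differ by [(p-1)^2 / (4p(p+1))]: they
   agree at [p = 1], and past it the first formula exceeds the claimed one. The overlap estimate in
   turn relies on [p >= 1]: when [g < 0] and [g >= 0] split a window into lengths [a] and [b], at
   least one of [a <= p b] and [b <= p a] must hold. *)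
Require Import Defs.
From HB Require Import structures.
From mathcomp Require Import all_boot all_order all_algebra.
From mathcomp Require Import complex.
From mathcomp Require Import all_classical all_reals all_analysis.
From mathcomp Require Import measurable_realfun ring lra.

Set Implicit Arguments.
Unset Strict Implicit.
Unset Printing Implicit Defensive.

Import Order.TTheory GRing.Theory Num.Theory.
Import numFieldNormedType.Exports.

Local Open Scope classical_set_scope.
Local Open Scope ring_scope.
Local Open Scope complex_scope.

(** * Integrals on the line *)

Section Basics.
Context {R : realType}.
Local Notation leb := (@lebesgue_measure R).
Implicit Types (f : R -> \bar R) (a b c : R).

(** The integral of a nonnegative function is a supremum over the simple functions below it, hence
    monotone. Integrands such as the energy of [u] can thus be compared pointwise straight from
    their definition. *)
Lemma integral_le_nonmeasurable d (T : measurableType d)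
    (m : {measure set T -> \bar R}) (D : set T) (f1 f2 : T -> \bar R) :
  (forall x, D x -> 0 <= f1 x)%E -> (forall x, D x -> f1 x <= f2 x)%E ->
  (\int[m]_(x in D) f1 x <= \int[m]_(x in D) f2 x)%E.
Proof.
move=> f10 f12; rewrite !ge0_integralE//; last first.
  by move=> x Dx; apply: le_trans (f12 _ Dx); exact: f10.
apply: ereal_sup_le => _ [h /= hf <-]; exists h => //= x.
apply: (le_trans (hf x)); rewrite /patch.
by case: ifPn => // /set_mem; exact: f12.
Qed.

Lemma integral_shift f c : measurable_fun [set: R] f -> (forall x, 0 <= f x)%E ->
  (\int[leb]_x f (x + c)%R = \int[leb]_x f x)%E.
Proof.
move=> mf f0.
have mphi : measurable_fun setT
    ((fun x : R => x + c) : measurableTypeR R -> measurableTypeR R).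
  exact: measurable_funD.
rewrite [LHS](_ : _ = \int[leb]_(x in ((fun x : R => (x + c)%R) @^-1` setT))
    (f \o (fun x : R => (x + c)%R)) x)%E; last by rewrite preimage_setT.
rewrite -(@ge0_integral_pushforward _ _ _ _ _ _ mphi) //.
apply: eq_measure_integral => //= A mA _.
apply/esym/(@lebesgue_measure_unique R
  (pushforward leb (fun x : R => x + c : measurableTypeR R))) => //= _ [[a b]] _ <-.
rewrite /pushforward.
rewrite [X in _ = leb X](_ : _ = `]a - c, b - c]%classic).
  rewrite !lebesgue_measure_itv/= !lte_fin ltrD2r -!EFinD.
  by case: ifP => // _; congr EFin; ring.
by apply/seteqP; split => x /=; rewrite !in_itv/= ltrBlDr lerBrDr.
Qed.

Lemma integral_opp f : measurable_fun [set: R] f -> (forall x, 0 <= f x)%E ->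
  (\int[leb]_x f (- x)%R = \int[leb]_x f x)%E.
Proof.
move=> mf f0.
have mphi : measurable_fun setT (-%R : measurableTypeR R -> measurableTypeR R).
  exact: oppr_measurable.
rewrite [LHS](_ : _ = \int[leb]_(x in (-%R%R @^-1` setT)) (f \o -%R%R) x)%E;
  last by rewrite preimage_setT.
rewrite -(@ge0_integral_pushforward _ _ _ _ _ _ mphi) //.
by apply: eq_measure_integral => //= A mA _; exact: lebesgue_measureN.
Qed.

Lemma integral_affine al be a b : a <= b ->
  (\int[leb]_(x in `[a, b]) (al * x + be)%:E =
   (al * (b ^+ 2 - a ^+ 2) / 2 + be * (b - a))%:E)%E.
Proof.
rewrite le_eqVlt => /predU1P[->|ab].
  by rewrite set_itv1 integral_set1 !subrr !mulr0 mul0r addr0.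
pose F x := al / 2 * x ^+ 2 + be * x.
have dF x : is_derive x (1:R) F (al * x + be).
  rewrite /F; apply: is_derive_eq.
  by rewrite /GRing.scale/= !mulr1; field.
have cF : continuous F.
  move=> x; apply/differentiable_continuous/derivable1_diffP.
  by have := dF x => -[].
rewrite (@continuous_FTC2 _ _ F)//.
- by rewrite -EFinB /F; congr EFin; field.
- apply: continuous_subspaceT => x.
  by apply: cvgD; [apply: cvgM; [exact: cvg_cst|exact: cvg_id]|exact: cvg_cst].
- split; first by move=> x _; have := dF x => -[].
  + by apply: cvg_at_right_filter; exact: cF.
  + by apply: cvg_at_left_filter; exact: cF.
- by move=> x _; rewrite derive1E; have := dF x => -[].
Qed.

(** The bound is asked on the open interval only: several profiles below are known under strict
    inequalities, and endpoints are null. *)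
Lemma integral_le_affine (f : R -> R) al be a b : a <= b ->
  measurable_fun [set: R] f ->
  (forall x, a < x -> x < b -> 0 <= f x <= al * x + be) ->
  (\int[leb]_(x in `[a, b]) (f x)%:E <=
   (al * (b ^+ 2 - a ^+ 2) / 2 + be * (b - a))%:E)%E.
Proof.
move=> ab mf fl; rewrite -integral_affine//.
have mEf : measurable_fun `]a, b[ (EFin \o f).
  exact/measurable_EFinP/measurable_funTS.
have mEg : measurable_fun `]a, b[ (fun x => (al * x + be)%:E).
  apply/measurable_EFinP/measurable_funTS/measurable_funD; last by [].
  exact: measurable_funM.
rewrite (integral_itv_bndoo _ _ mEf) (integral_itv_bndoo _ _ mEg).
apply: integral_le_nonmeasurable => x; rewrite /= in_itv/= => /andP[ax xb].
  by rewrite lee_fin; case/andP: (fl _ ax xb).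
by rewrite lee_fin; case/andP: (fl _ ax xb).
Qed.

Lemma integral_support (f : R -> R) a b :
  (forall x, x < a -> f x = 0) -> (forall x, b < x -> f x = 0) ->
  (\int[leb]_x (f x)%:E = \int[leb]_(x in `[a, b]) (f x)%:E)%E.
Proof.
move=> fa fb; rewrite [RHS]integral_mkcond; apply: eq_integral => x _.
rewrite patchE; case: ifPn => //; rewrite notin_setE/= in_itv/= => /negP.
rewrite negb_and -!ltNge => /orP[/fa->|/fb->] //.
Qed.

Lemma integral_split (f : R -> R) a b c : a <= b -> b <= c ->
  measurable_fun [set: R] f -> (forall x, 0 <= f x) ->
  (\int[leb]_(x in `[a, c]) (f x)%:E =
   \int[leb]_(x in `[a, b]) (f x)%:E + \int[leb]_(x in `[b, c]) (f x)%:E)%E.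
Proof.
move=> ab bc mf f0.
have -> : `[a, c]%classic = `[a, b[%classic `|` `[b, c]%classic.
  by rewrite -itv_bndbnd_setU// bnd_simp.
have mEf D : measurable_fun D (EFin \o f).
  exact/measurable_EFinP/measurable_funTS.
rewrite ge0_integral_setU//; last 3 first.
- exact: mEf.
- by move=> x _; rewrite lee_fin.
- apply/disj_setPS => x [/=]; rewrite !in_itv/= => /andP[_ xb] /andP[].
  by rewrite leNgt xb.
by rewrite integral_itv_bndo_bndc//; exact: mEf.
Qed.

(** [g x - L * x] is nonincreasing, hence measurable. *)
Lemma measurable_upper_lipschitz (g : R -> R) L :
  (forall x y, x <= y -> g y - g x <= L * (y - x)) -> measurable_fun setT g.
Proof.
move=> gL.
rewrite [g](_ : _ = (fun x => (g x - L * x) + L * x)); last first.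
  by apply/funext => x; rewrite subrK.
apply: measurable_funD; last exact: mulrl_measurable.
have dec (x y : R) : x <= y -> g y - L * y <= g x - L * x.
  by move=> xy; have gLxy := gL _ _ xy; lra.
by apply: nonincreasing_measurable => //= x y _ _ xy; exact: dec.
Qed.

End Basics.

(** * From the derivative bound to increments *)

Section UpperLipschitz.
Context {R : realType}.
Local Notation leb := (@lebesgue_measure R).

(** Real induction. The step straddles [t], so at the supremum of the good points it starts from a
    good point just below and ends past the supremum, unless [hi] is reached. *)
Lemma interval_induction (P : R -> Prop) (lo hi : R) : lo <= hi -> P lo ->
  (forall t, lo <= t <= hi -> exists2 r, 0 < r & forall z z',
     lo <= z <= t -> t <= z' <= hi -> t - z < r -> z' - t < r -> P z -> P z') ->
  P hi.
Proof.
move=> lohi Plo step.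
pose S := [set x | lo <= x <= hi /\ P x].
have Slo : S lo by split; rewrite ?lexx.
have hS : has_sup S by split; [exists lo|exists hi => x [/andP[]]].
have lo_s : lo <= sup S by apply: ub_le_sup => //; case: hS.
have s_hi : sup S <= hi by apply: ge_sup; [exists lo|move=> x [/andP[]]].
have [r r0 Hr] := step (sup S) (introT andP (conj lo_s s_hi)).
have [x [/andP[lox xhi] Px] sx] := sup_adherent r0 hS.
have xs : x <= sup S by apply: ub_le_sup; [case: hS|split=> //; exact/andP].
pose x' := Num.min hi (sup S + r / 2).
have sx' : sup S <= x' by rewrite /x' le_min s_hi/= lerDl; apply: divr_ge0 => //; exact: ltW.
have x'hi : x' <= hi by rewrite /x' ge_min lexx.
have x's : x' <= sup S + r / 2 by rewrite /x' ge_min lexx orbT.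
have Px' : P x'.
  apply: (Hr x x') => //; [exact/andP|exact/andP| |]; lra.
have /ub_le_sup : S x' by split=> //; rewrite x'hi (le_trans lo_s sx').
move=> /(_ (proj2 hS)) x'S.
suff -> : hi = x' by [].
move: x'S; rewrite /x' /Num.min; case: ifPn => // _; lra.
Qed.

(** Straddle estimate: the increments from [z] to [t] and from [t] to [z'] satisfy the bound
    separately and add up. This is the form that [interval_induction] asks for. *)
Lemma derivable_increment (f : R -> R) (t L e : R) : derivable f t 1 ->
  derive1 f t <= L -> 0 < e -> exists2 r, 0 < r & forall z z',
    z <= t -> t <= z' -> t - z < r -> z' - t < r ->
    f z' - f z <= (L + e) * (z' - z).
Proof.
rewrite derive1E => df dL e0.
have /cvgrPdist_lt/(_ _ e0) :
    h^-1 *: ((f \o shift t) (h *: (1:R)) - f t) @[h --> 0^'] --> 'D_1 f t by exact: df.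
move=> [r/= r0 Hr]; exists r => // z z' zt tz' zr z'r.
have key h : h != 0 -> `|h| < r -> h^-1 * (f (h + t) - f t) < L + e.
  move=> h0 hr.
  have := Hr h; rewrite /ball/= sub0r normrN => /(_ hr h0).
  rewrite /= /GRing.scale/= mulr1 ltr_norml => /andP[+ _].
  by move=> ?; lra.
have right : f z' - f t <= (L + e) * (z' - t).
  have [->|zt'] := eqVneq z' t; first by rewrite !subrr mulr0.
  have h0 : 0 < z' - t by rewrite subr_gt0 lt_neqAle eq_sym zt'.
  have := key (z' - t); rewrite gt_eqF// gtr0_norm// subrK => /(_ isT z'r).
  by rewrite mulrC ltr_pdivrMr// => /ltW.
have left : f t - f z <= (L + e) * (t - z).
  have [->|zt'] := eqVneq z t; first by rewrite !subrr mulr0.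
  have h0 : 0 < t - z by rewrite subr_gt0 lt_neqAle zt'.
  have := key (- (t - z)); rewrite oppr_eq0 normrN gt_eqF// gtr0_norm//.
  move=> /(_ isT zr); rewrite opprB subrK -opprB invrN mulNr -mulrN opprB.
  by rewrite mulrC ltr_pdivrMr// => /ltW.
lra.
Qed.

(** The exceptional null set is enclosed in an open [U] of measure below the [delta] of absolute
    continuity. Increments over pieces inside [U] then sum to less than [e], and near every other
    point the derivative bounds the increment. *)
Lemma upper_abs_continuous_le (f : R -> R) (L lo hi : R) : 0 <= L -> lo <= hi ->
  upper_abs_continuous lo hi f ->
  {ae leb, forall t, lo <= t -> derivable f t 1} ->
  {ae leb, forall t, lo <= t -> derive1 f t <= L} ->
  f hi - f lo <= L * (hi - lo).
Proof.
move=> L0 lohi ac [N1 [mN1 N10 subN1]] [N2 [mN2 N20 subN2]].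
suff H (e : R) : 0 < e -> f hi - f lo <= (L + e) * (hi - lo) + e.
  apply/ler_addgt0Pr => e e0.
  have d0 : 0 < hi - lo + 1 by lra.
  have := H (e / (hi - lo + 1)) (divr_gt0 e0 d0).
  move=> /le_trans; apply; rewrite le_eqVlt; apply/orP; left; apply/eqP.
  by field; rewrite gt_eqF.
move=> e0.
have [del del0 Hdel] := ac _ e0.
have mN := measurableU _ _ mN1 mN2.
have N0 : leb (N1 `|` N2) = 0%E.
  have /= := measureU2 leb mN1 mN2; rewrite N10 N20 adde0 => N0.
  by apply/eqP; rewrite eq_le measure_ge0 andbT.
have [|U [oU NU Ud]] := lebesgue_regularity_outer mN _ del0.
  by rewrite [X in (X < _)%E]N0.
have mU : measurable U by exact: open_measurable.
have Udel : (leb U < del%:E)%E.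
  have /= := measureU2 leb mN (measurableD mU mN).
  by rewrite N0 add0e (setDUK NU) => /le_lt_trans; apply.
(* [W x] is the budget of length for pieces inside [U] up to [x]: by [Wadd] a new piece in [U]
   raises it by exactly its length, and it never reaches [del]. *)
pose W x := fine (leb (U `&` `]lo, x])).
have WE x : leb (U `&` `]lo, x]) = (W x)%:E.
  rewrite /W fineK// ge0_fin_numE//; apply: le_lt_trans (lt_trans Udel (ltry _)).
  by apply: le_measure; rewrite ?inE//; exact: measurableI.
have Wdel x : W x < del.
  rewrite -lte_fin -WE; apply: le_lt_trans Udel.
  by apply: le_measure; rewrite ?inE//; exact: measurableI.
have Wadd (z z' : R) : lo <= z -> z <= z' -> `[z, z'] `<=` U -> W z' = W z + (z' - z).
  move=> loz zz' zU; apply: EFin_inj; rewrite EFinD -!WE.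
  have -> : U `&` `]lo, z'] = (U `&` `]lo, z]) `|` `]z, z'].
    apply/seteqP; split=> x /=; rewrite !in_itv/=.
      by move=> [Ux /andP[-> ->]]; have [xz|zx] := leP x z; [left|right].
    move=> [[Ux /andP[-> xz]]|/andP[zx xz']]; first by rewrite (le_trans xz zz').
    split; first by apply: zU; rewrite /= in_itv/= xz' ltW.
    by rewrite xz' (le_lt_trans loz zx).
  rewrite measureU//=; first last.
  - rewrite -subset0 => x /=; rewrite !in_itv/= => -[[_ /andP[_ xz]] /andP[]].
    by rewrite ltNge xz.
  - exact: measurableI.
  congr (_ + _)%E; rewrite lebesgue_measure_itv/= lte_fin.
  by case: ifPn => //; rewrite -leNgt => z'z; rewrite (@le_anti _ _ z z') ?subrr// zz' z'z.
(* [P x] records the pieces of a subdivision of [lo, x] that lie inside the small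
   open set [U]; all other pieces satisfy the derivative bound up to [e]. *)
pose P x := exists m (a b : nat -> R), [/\
  forall i, (i < m)%N -> lo <= a i /\ a i <= b i /\ b i <= x,
  forall i j, (i < j)%N -> (j < m)%N -> b i <= a j,
  \sum_(i < m) (b i - a i) <= W x &
  f x - f lo <= (L + e) * (x - lo) + \sum_(i < m) (f (b i) - f (a i))].
have Phi : P hi.
  apply: (interval_induction lohi).
    exists 0%N, (fun _ => lo), (fun _ => lo); split => //.
      by rewrite big_ord0 fine_ge0.
    by rewrite big_ord0 !subrr mulr0 addr0.
  move=> t /andP[lot thi].
  have [r r0 Hr] : exists2 r, 0 < r & forall z z', z <= t -> t <= z' ->
      t - z < r -> z' - t < r ->
      f z' - f z <= (L + e) * (z' - z) \/ `[z, z'] `<=` U.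
    have [tN|tN] := pselect ((N1 `|` N2) t).
      have /nbhs_ballP[r/= r0 rU] : nbhs t U.
        by apply: open_nbhs_nbhs; split => //; exact: NU.
      exists r => // z z' zt tz' zr z'r; right => x /=; rewrite in_itv/= => /andP[zx xz'].
      by apply: rU; rewrite /ball/= ltr_distl; apply/andP; split; lra.
    have dt : derivable f t 1.
      by apply: contrapT => nd; apply: tN; left; apply: subN1 => /= /(_ lot).
    have Lt : derive1 f t <= L.
      by apply: contrapT => nd; apply: tN; right; apply: subN2 => /= /(_ lot).
    have [r r0 Hr] := derivable_increment dt Lt e0.
    by exists r => // z z' zt tz' zr z'r; left; exact: Hr.
  exists r => // z z' /andP[loz zt] /andP[tz' z'hi] zr z'r [m [a [b [ab bab sW fs]]]].
  have zz' : z <= z' by exact: le_trans tz'.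
  have [good|bad] := Hr z z' zt tz' zr z'r.
    exists m, a, b; split => //.
    - by move=> i /ab[? [? ?]]; do !split => //; exact: le_trans zz'.
    - apply: (le_trans sW); rewrite -lee_fin -!WE; apply: le_measure.
      + by rewrite inE; exact: measurableI.
      + by rewrite inE; exact: measurableI.
      + by apply: setIS => x /=; rewrite !in_itv/= => /andP[-> /le_trans]; exact.
    - by lra.
  exists m.+1, (fun i => if (i < m)%N then a i else z),
    (fun i => if (i < m)%N then b i else z').
  split.
  - move=> i im; case: ifPn => [/ab[? [? ?]]|_]; last by [].
    by do !split => //; exact: le_trans zz'.
  - move=> i j ij jm; have im : (i < m)%N by rewrite (leq_trans ij).
    rewrite im; case: ifPn => jm'; first exact: bab.
    by case: (ab _ im) => _ [].
  - rewrite big_ord_recr/= ltnn (Wadd z)// lerD2r.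
    by under eq_bigr do rewrite ltn_ord.
  - rewrite big_ord_recr/= ltnn.
    under eq_bigr do rewrite ltn_ord.
    have : 0 <= (L + e) * (z' - z) by apply: mulr_ge0; lra.
    by lra.
have [m [a [b [ab bab sW fs]]]] := Phi.
apply: (le_trans fs); rewrite lerD2l; apply: ltW; apply: Hdel => //.
exact: le_lt_trans sW _.
Qed.

End UpperLipschitz.

(** * Windows through a point *)

Section Windows.
Context {R : realType}.
Local Notation leb := (@lebesgue_measure R).

(** Boolean, so that its [%:R] is the indicator kernel to which Tonelli applies. *)
Definition between_delayed (g : R -> R) (x s : R) : bool :=
  (Num.min x (x - g x) <= s) && (s <= Num.max x (x - g x)).

Definition upper_lipschitz (L : R) (g : R -> R) :=
  forall x y, x <= y -> g y - g x <= L * (y - x).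

Lemma measurable_between_delayed d (T : measurableType d) (g : R -> R) (a b : T -> R) :
  measurable_fun [set: R] g -> measurable_fun [set: T] a -> measurable_fun [set: T] b ->
  measurable_fun [set: T] (fun t => (between_delayed g (a t) (b t))%:R : R).
Proof.
move=> mg ma mb.
have mga : measurable_fun [set: T] (fun t => a t - g (a t)).
  by apply: measurable_funB => //; exact: measurableT_comp.
rewrite [X in measurable_fun _ X](_ : _ =
    (fun t => if between_delayed g (a t) (b t) then 1 else 0)); last first.
  by apply/funext => t; case: between_delayed.
apply: measurable_fun_ifT => //; apply: measurable_and.
  by apply: measurable_fun_ler => //; exact: measurable_minr.
by apply: measurable_fun_ler => //; exact: measurable_maxr.
Qed.

Lemma between_delayed_shift (g : R -> R) c x s :
  between_delayed (fun x => g (x + c)) x s = between_delayed g (x + c) (s + c).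
Proof.
by rewrite /between_delayed !ge_min !le_max !lerD2r addrAC !lerD2r.
Qed.

Lemma between_delayed_opp (g : R -> R) x s :
  between_delayed (fun x => - g (- x)) x s = between_delayed g (- x) (- s).
Proof.
rewrite /between_delayed !ge_min !le_max andbC.
have -> : - x - g (- x) = - (x - - g (- x)) by ring.
by rewrite !lerN2.
Qed.

Lemma upper_lipschitz_shift L (g : R -> R) c : upper_lipschitz L g ->
  upper_lipschitz L (fun x => g (x + c)).
Proof.
move=> gL x y xy; have := gL (x + c) (y + c); rewrite lerD2r => /(_ xy).
by rewrite (_ : y + c - (x + c) = y - x)//; ring.
Qed.

(** Reversing both the points and the values keeps an upper slope bound an upper slope bound. This
    symmetry is what allows assuming [0 <= g 0] in the estimates at 0. *)
Lemma upper_lipschitz_opp L (g : R -> R) : upper_lipschitz L g ->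
  upper_lipschitz L (fun x => - g (- x)).
Proof.
move=> gL x y xy; have := gL (- y) (- x); rewrite lerN2 => /(_ xy).
by move=> ?; lra.
Qed.

(** The window of [x] contains 0 when [x <= g x] for [x > 0], and when [g x <= x] for [x < 0]. If
    [a] is the distance from 0 to the windows that reach it from the left, the integrand lies below
    [min mu ((1 + p) * x + p * a)] on the right, vanishes on []- a, 0[], and lies below
    [min mu ((1 + p) * |x| - p * a)] further left. The area under these profiles is largest at
    [a = 0]. *)
Lemma integral_hit_time_le0 (g : R -> R) (mu p : R) : 0 < mu -> 0 <= p -> p <= 1 ->
  (forall x, `|g x| <= mu) -> upper_lipschitz (1 + p) g -> 0 <= g 0 ->
  (\int[leb]_x (`|g x| * (between_delayed g x 0)%:R)%:E <=
   (mu ^+ 2 * ((2 * p + 1) / (p + 1)))%:E)%E.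
Proof.
move=> mu0 p0 p1 gmu gL g0.
have mg := measurable_upper_lipschitz gL.
have p10 : 0 < 1 + p by lra.
have mu2 : 0 <= mu ^+ 2 by rewrite exprn_ge0// ltW.
pose phi (x : R) : R := `|g x| * (between_delayed g x 0)%:R.
have mphi : measurable_fun [set: R] phi.
  apply: measurable_funM; first exact: measurableT_comp.
  exact: measurable_between_delayed.
have phi0 x : 0 <= phi x by rewrite mulr_ge0.
have phimu x : phi x <= mu.
  by apply: le_trans (gmu x); rewrite ler_piMr// lern1 leq_b1.
have gmu' x : - mu <= g x <= mu by rewrite -ler_norml.
have pos (x : R) : 0 < x -> phi x = 0 \/ (x <= g x /\ phi x = g x).
  move=> x0; rewrite /phi; have [xg|xg] := boolP (x - g x <= 0).
    right; have -> : between_delayed g x 0.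
      by rewrite /between_delayed ge_min le_max xg (ltW x0) !orbT.
    by rewrite mulr1 ger0_norm; lra.
  left; have -> : between_delayed g x 0 = false.
    by apply: negbTE; rewrite /between_delayed ge_min negb_and negb_or xg -ltNge x0.
  by rewrite mulr0.
have neg (x : R) : x < 0 -> phi x = 0 \/ (g x <= x /\ phi x = - g x).
  move=> x0; rewrite /phi; have [xg|xg] := boolP (0 <= x - g x).
    right; have -> : between_delayed g x 0.
      by rewrite /between_delayed ge_min le_max xg (ltW x0) !orbT.
    by rewrite mulr1 ler0_norm; lra.
  left; have -> : between_delayed g x 0 = false.
    apply: negbTE; rewrite /between_delayed le_max negb_and negb_or xg orbC.
    by rewrite -ltNge x0.
  by rewrite mulr0.
have phi_out x : mu < `|x| -> phi x = 0.
  move=> xmu; have [x0|x0|x0] := ltgtP x 0.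
  - case: (neg _ x0) => // -[gx _]; have := gmu' x.
    by move: xmu; rewrite ltr0_norm//; lra.
  - case: (pos _ x0) => // -[gx _]; have := gmu' x.
    by move: xmu; rewrite gtr0_norm//; lra.
  - by move: xmu; rewrite x0 normr0; lra.
rewrite (@integral_support _ phi (- mu) mu); last 2 first.
- by move=> x xmu; apply: phi_out; rewrite ltr0_norm; lra.
- by move=> x xmu; apply: phi_out; rewrite gtr0_norm; lra.
rewrite (@integral_split _ _ _ 0)//; [|lra|lra].
pose N := [set v : R | 0 < v <= mu /\ g (- v) <= - v].
have [N0|[v1 Nv1]] : N = set0 \/ N !=set0.
- by case: (pselect (N !=set0)) => [|/set0P/negP/negPn/eqP]; [right|left].
- have le1 : (\int[leb]_(x in `[(- mu)%R, 0%R]) (phi x)%:E <=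
      (0 * (0 ^+ 2 - (- mu) ^+ 2) / 2 + 0 * (0 - - mu))%R%:E)%E.
    apply: integral_le_affine => //; first lra.
    move=> x xmu x0; rewrite phi0 mul0r addr0/=.
    have [->//|[gx _]] := neg _ x0.
    have : N (- x) by split; rewrite ?opprK//; apply/andP; split; lra.
    by rewrite N0.
  have le2 : (\int[leb]_(x in `[0%R, mu]) (phi x)%:E <=
      (0 * (mu ^+ 2 - 0 ^+ 2) / 2 + mu * (mu - 0))%R%:E)%E.
    apply: integral_le_affine => //; first lra.
    by move=> x x0 xmu; rewrite phi0 mul0r add0r/=.
  apply: (le_trans (leeD le1 le2)); rewrite -EFinD lee_fin.
  rewrite !mul0r !add0r subr0 -expr2 ler_peMr// ler_pdivlMr; lra.
(* Comparing [g] with its values at points [- v], [v] in [N] close to [a], bounds it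
   on the right of 0; comparing it with points [- v], [v < a] outside [N], bounds it
   on the left of [- a]. *)
have infN : has_inf N by split; [exists v1|exists 0 => v [/andP[/ltW]]].
pose a := inf N.
have a0 : 0 <= a by apply: lb_le_inf; [exists v1|move=> v [/andP[/ltW]]].
have aN v : N v -> a <= v by move=> Nv; apply: ge_inf => //; case: infN.
have amu : a <= mu by apply: le_trans (aN _ Nv1) _; case: Nv1 => /andP[].
have posB (x : R) : 0 < x -> phi x <= (1 + p) * x + p * a.
  move=> x0; have [->|[gx ->]] := pos _ x0.
    by rewrite addr_ge0// mulr_ge0// ltW.
  apply/ler_addgt0Pr => e e0.
  have e'0 : 0 < e / (1 + p) by exact: divr_gt0.
  have [v [/andP[v0 _] gv] va] := inf_adherent e'0 infN.
  have xv : - v <= x by lra.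
  have := gL _ _ xv.
  have : p * v <= p * (a + e / (1 + p)) by rewrite ler_wpM2l// ltW.
  have : p * (e / (1 + p)) <= e by rewrite mulrCA ler_piMr ?ltW// ltr_pdivrMr//; lra.
  lra.
have negB (x : R) : x < - a -> phi x <= - (1 + p) * x + - p * a.
  move=> xa; have x0 : x < 0 by lra.
  have [->|[gx ->]] := neg _ x0.
    have : 0 <= p * (- x - a) by rewrite mulr_ge0//; lra.
    by lra.
  (* For [a = 0] there is no point of []0, a[] to compare with; the comparison is with 0 itself,
     through the sign of [g 0]. *)
  have [aE|aN0] := eqVneq a 0.
    by have := gL _ _ (ltW x0); rewrite aE; lra.
  have ap : 0 < a by rewrite lt_neqAle eq_sym aN0.
  apply/ler_addgt0Pr => e e0.
  have e'0 : 0 < e / (1 + p) by exact: divr_gt0.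
  (* Just below [a], hence outside [N]; [a / 2] keeps it positive. *)
  pose v := Num.max (a / 2) (a - e / (1 + p)).
  have v0 : 0 < v by rewrite lt_max divr_gt0.
  have va : v < a by rewrite gt_max; apply/andP; split; lra.
  have ve : a - e / (1 + p) <= v by rewrite le_max lexx orbT.
  have xv : x <= - v by lra.
  have gv : - v < g (- v).
    rewrite ltNge; apply/negP => gv; have : N v by split => //; apply/andP; split; lra.
    by move/aN; rewrite leNgt va.
  have := gL _ _ xv.
  have : p * (a - e / (1 + p)) <= p * v by rewrite ler_wpM2l.
  have : p * (e / (1 + p)) <= e by rewrite mulrCA ler_piMr ?ltW// ltr_pdivrMr//; lra.
  lra.
have neg0 (x : R) : - a < x -> x < 0 -> phi x = 0.
  move=> ax x0; have [//|[gx _]] := neg _ x0.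
  have : N (- x) by split; [apply/andP; split; lra|rewrite opprK].
  by move/aN; lra.
(* The right ramp reaches the height [mu] at [w], the left one at [- v]. The assumption [p <= 1]
   gives [p * a <= mu], so that [0 <= w]. *)
pose w := (mu - p * a) / (1 + p).
pose v := (mu + p * a) / (1 + p).
have pa : p * a <= mu by apply: le_trans amu; rewrite ler_piMl.
have pa0 : 0 <= p * a by exact: mulr_ge0.
have w0 : 0 <= w by rewrite divr_ge0//; lra.
have wmu : w <= mu by rewrite ler_pdivrMr//; have : 0 <= mu * p; [rewrite mulr_ge0// ltW|lra].
have av : a <= v by rewrite ler_pdivlMr//; lra.
have vmu : v <= mu by rewrite ler_pdivrMr//; have : p * a <= p * mu; [rewrite ler_wpM2l|lra].
rewrite (@integral_split _ _ 0 w mu)//.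
rewrite (@integral_split _ _ (- mu) (- v) 0)//; [|lra|lra].
rewrite (@integral_split _ _ (- v) (- a) 0)//; [|lra|lra].
have i1 : (\int[leb]_(x in `[(- mu)%R, (- v)%R]) (phi x)%:E <=
    (0 * ((- v) ^+ 2 - (- mu) ^+ 2) / 2 + mu * (- v - - mu))%R%:E)%E.
  apply: integral_le_affine => //; first lra.
  by move=> x _ _; rewrite phi0 mul0r add0r/=.
have i2 : (\int[leb]_(x in `[(- v)%R, (- a)%R]) (phi x)%:E <=
    (- (1 + p) * ((- a) ^+ 2 - (- v) ^+ 2) / 2 + (- p * a) * (- a - - v))%R%:E)%E.
  apply: integral_le_affine => //; first lra.
  by move=> x _ xa; rewrite phi0/=; exact: negB.
have i3 : (\int[leb]_(x in `[(- a)%R, 0%R]) (phi x)%:E <=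
    (0 * (0 ^+ 2 - (- a) ^+ 2) / 2 + 0 * (0 - - a))%R%:E)%E.
  apply: integral_le_affine => //; first lra.
  by move=> x ax x0; rewrite neg0// mul0r addr0 lexx.
have i4 : (\int[leb]_(x in `[0%R, w]) (phi x)%:E <=
    ((1 + p) * (w ^+ 2 - 0 ^+ 2) / 2 + (p * a) * (w - 0))%R%:E)%E.
  apply: integral_le_affine => //.
  by move=> x x0 _; rewrite phi0/=; exact: posB.
have i5 : (\int[leb]_(x in `[w, mu]) (phi x)%:E <=
    (0 * (mu ^+ 2 - w ^+ 2) / 2 + mu * (mu - w))%R%:E)%E.
  apply: integral_le_affine => //.
  by move=> x _ _; rewrite phi0 mul0r add0r/=.
apply: (le_trans (leeD (leeD i1 (leeD i2 i3)) (leeD i4 i5))).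
rewrite -!EFinD lee_fin.
have e1 : (1 + p) * w ^+ 2 = w * (mu - p * a).
  by rewrite expr2 mulrA mulrC [_ * w]mulrC divfK ?gt_eqF.
have e2 : (1 + p) * v ^+ 2 = v * (mu + p * a).
  by rewrite expr2 mulrA mulrC [_ * v]mulrC divfK ?gt_eqF.
(* The last fraction is the exact loss compared with the worst case [a = 0]. *)
have -> : mu ^+ 2 * ((2 * p + 1) / (p + 1)) =
    2 * mu ^+ 2 - w * (mu - p * a) / 2 - v * (mu + p * a) / 2 + (p - 1) * a ^+ 2 / 2
    + (p ^+ 2 + 1) * a ^+ 2 / (2 * (1 + p)).
  by rewrite /w /v; field; rewrite gt_eqF.
have : 0 <= (p ^+ 2 + 1) * a ^+ 2 / (2 * (1 + p)).
  by rewrite divr_ge0 ?mulr_ge0 ?addr_ge0 ?sqr_ge0//; lra.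
lra.
Qed.

(** Translation brings [s] to 0, and a negative value of [g] there is made positive by the
    reflection. *)
Lemma integral_hit_time_le (g : R -> R) (mu p s : R) : 0 < mu -> 0 <= p -> p <= 1 ->
  (forall x, `|g x| <= mu) -> upper_lipschitz (1 + p) g ->
  (\int[leb]_x (`|g x| * (between_delayed g x s)%:R)%:E <=
   (mu ^+ 2 * ((2 * p + 1) / (p + 1)))%:E)%E.
Proof.
move=> mu0 p0 p1 gmu gL.
have mg := measurable_upper_lipschitz gL.
pose f (x : R) : \bar R := (`|g x| * (between_delayed g x s)%:R)%:E.
have mf : measurable_fun [set: R] f.
  apply/measurable_EFinP/measurable_funM; first exact: measurableT_comp.
  exact: measurable_between_delayed.
have f0 x : (0 <= f x)%E by rewrite lee_fin mulr_ge0.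
rewrite -(integral_shift s mf f0).
have fE x : f (x + s) = (`|g (x + s)| * (between_delayed (fun x => g (x + s)) x 0)%:R)%:E.
  by rewrite between_delayed_shift add0r.
have gLs := upper_lipschitz_shift s gL.
have [gs|gs] := leP 0 (g (0 + s)).
  under eq_integral do rewrite fE.
  exact: (integral_hit_time_le0 mu0 p0 p1 _ gLs).
rewrite -integral_opp; last 2 first.
- by apply: measurableT_comp => //; exact: measurable_funD.
- by move=> x; exact: f0.
have fE' x : f (- x + s) =
    (`|- g (- x + s)| * (between_delayed (fun x => - g (- x + s)) x 0)%:R)%:E.
  by rewrite fE (between_delayed_opp (fun x => g (x + s))) oppr0 normrN.
under eq_integral do rewrite fE'.
apply: (integral_hit_time_le0 mu0 p0 p1 _ (upper_lipschitz_opp gLs)).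
  by move=> x; rewrite normrN.
by rewrite !oppr0 oppr_ge0 ltW.
Qed.

End Windows.

(** * Integrating against a cumulative measure *)

Section Ramp.
Context {R : realType}.
Local Notation leb := (@lebesgue_measure R).

Lemma integral_self_cumulative (W : set R) (b : R) : measurable W ->
  leb W = b%:E ->
  (\int[leb]_(x in W) leb (W `&` `]-oo, x]) = (b ^+ 2 / 2)%:E)%E.
Proof.
move=> mW Wb.
have mI (i : interval R) : measurable (W `&` [set` i]) by exact: measurableI.
have lE (i : interval R) : leb (W `&` [set` i]) = (\int[leb]_y (\1_(W `&` [set` i]) y)%:E)%E.
  by rewrite integral_indic//; [rewrite setIT|exact: mI].
pose F (z : R * R) : \bar R := (\1_W z.1 * \1_W z.2 * (z.2 <= z.1)%R%:R)%:E.
have mle : measurable_fun [set: R * R] (fun z => (z.2 <= z.1)%R%:R : R).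
  rewrite [X in measurable_fun _ X](_ : _ =
      (fun z => if z.2 <= z.1 then 1 else 0)); last first.
    by apply/funext => z; case: ifP.
  by apply: measurable_fun_ifT => //; exact: measurable_fun_ler.
have mF : measurable_fun [set: R * R] F.
  apply/measurable_EFinP; apply: measurable_funM => //.
  by apply: measurable_funM; apply: measurableT_comp => //; exact: measurable_indic.
have F0 z : (0 <= F z)%E by rewrite lee_fin !mulr_ge0.
have F1 x : (\int[leb]_y F (x, y) = (\1_W x)%:E * leb (W `&` `]-oo, x]))%E.
  rewrite lE -ge0_integralZl_EFin//; last first.
    by apply/measurable_EFinP; apply: measurable_indic; exact: mI.
  apply: eq_integral => y _; rewrite /F/= -EFinM -mulrA; congr (_ * _)%:E.
  rewrite !indicE in_setI -natrM mulnb; congr (_ && _)%:R.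
  by rewrite mem_setE in_itv.
have F2 y : (\int[leb]_x F (x, y) = (\1_W y)%:E * leb (W `&` `[y, +oo[))%E.
  rewrite lE -ge0_integralZl_EFin//; last first.
    by apply/measurable_EFinP; apply: measurable_indic; exact: mI.
  apply: eq_integral => x _; rewrite /F/= -EFinM [\1_W x * _]mulrC -mulrA; congr (_ * _)%:E.
  rewrite !indicE in_setI -natrM mulnb; congr (_ && _)%:R.
  by rewrite mem_setE in_itv/= andbT.
(* Tonelli exchanges the lower and upper cumulative integrals, whose sum is [b * b]. *)
have := fubini_tonelli (m1 := leb) (m2 := leb) F mF F0.
under eq_integral do rewrite F1.
under [in RHS]eq_integral do rewrite F2.
have mk (f : R -> \bar R) :
    (\int[leb]_(x in W) f x = \int[leb]_x ((\1_W x)%:E * f x))%E.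
  rewrite integral_mkcond; apply: eq_integral => x _; rewrite patchE indicE.
  by case: ifP => _; rewrite ?mul1e ?mul0e.
rewrite -!mk => A12.
have mcum1 : measurable_fun W (fun x => leb (W `&` `]-oo, x])).
  have mG := measurable_fun_fubini_tonelli_F (m2 := leb) F mF F0.
  apply: eq_measurable_fun (measurable_funTS mG) => x xW.
  by rewrite /fubini_F F1 indicE xW mul1e.
have mcum2 : measurable_fun W (fun x => leb (W `&` `[x, +oo[)).
  have mG := measurable_fun_fubini_tonelli_G (m1 := leb) F mF F0.
  apply: eq_measurable_fun (measurable_funTS mG) => x xW.
  by rewrite /fubini_G F2 indicE xW mul1e.
have : (\int[leb]_(x in W) leb (W `&` `]-oo, x]) +
        \int[leb]_(x in W) leb (W `&` `[x, +oo[) = (b * b)%:E)%E.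
  rewrite -ge0_integralD//.
  transitivity (\int[leb]_(x in W) (b%:E))%E.
    apply: eq_integral => x _.
    have -> : leb (W `&` `[x, +oo[) = leb (W `&` `]x, +oo[).
      have -> : W `&` `[x, +oo[ = (W `&` `]x, +oo[) `|` (W `&` [set x]).
        by rewrite -setIUr setUC setU1itv.
      apply: measureU0; [exact: mI|exact: measurableI|].
      apply: (@subset_measure0 _ _ _ leb _ [set x]) => //.
        exact: measurableI.
      exact: lebesgue_measure_set1.
    rewrite -measureU; [|exact: mI|exact: mI|].
      by rewrite -setIUr -itv_bndbnd_setU// set_itvNyy setIT.
    rewrite -subset0 => y [[_ +] [_]]; rewrite /= !in_itv/= andbT => yx.
    by rewrite ltNge yx.
  by rewrite integral_cst// [X in (_ * X)%E]Wb.
rewrite -A12; case: (\int[leb]_(x in W) _)%E => [r|//|//].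
by rewrite -EFinD => -[rr]; congr EFin; rewrite expr2 -rr; field.
Qed.

Definition cumulative (W : set R) (x : R) : R := fine (leb (W `&` `]-oo, x])).

Lemma cumulativeE (W : set R) (b x : R) : measurable W -> leb W = b%:E ->
  leb (W `&` `]-oo, x]) = (cumulative W x)%:E.
Proof.
move=> mW Wb; rewrite fineK// ge0_fin_numE//.
apply: (@le_lt_trans _ _ b%:E); last exact: ltry.
rewrite -Wb; apply: le_measure; rewrite ?inE//.
exact: measurableI.
Qed.

Lemma integral_cumulative (W : set R) (b : R) : measurable W -> leb W = b%:E ->
  (\int[leb]_(x in W) (cumulative W x)%:E = (b ^+ 2 / 2)%:E)%E.
Proof.
move=> mW Wb; rewrite -(integral_self_cumulative mW Wb).
by apply: eq_integral => x _; rewrite (cumulativeE _ mW Wb).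
Qed.

Lemma le_cumulative (W : set R) (b x y : R) : measurable W -> leb W = b%:E ->
  x <= y -> cumulative W x <= cumulative W y <= cumulative W x + (y - x).
Proof.
move=> mW Wb xy.
have mI (i : interval R) : measurable (W `&` [set` i]) by exact: measurableI.
apply/andP; split.
  rewrite -lee_fin -!(cumulativeE _ mW Wb); apply: le_measure; rewrite ?inE//; try exact: mI.
  by apply: setIS => z /=; rewrite !in_itv/= => /le_trans; exact.
rewrite -lee_fin EFinD -!(cumulativeE _ mW Wb).
have -> : W `&` `]-oo, y] = (W `&` `]-oo, x]) `|` (W `&` `]x, y]).
  by rewrite -setIUr -itv_bndbnd_setU.
apply: (le_trans (measureU2 leb (mI _) (mI _))); apply: leeD => //.
have : leb `]x, y] = (y - x)%:E.
  rewrite lebesgue_measure_itv/= lte_fin; case: ltgtP xy => //.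
  move=> -> _; by rewrite subrr.
by move=> <-; apply: le_measure; rewrite ?inE//; exact: mI.
Qed.

Lemma measurable_cumulative (W : set R) (b : R) : measurable W ->
  leb W = b%:E -> measurable_fun [set: R] (cumulative W).
Proof.
move=> mW Wb; apply: (@measurable_upper_lipschitz _ _ 1) => x y xy.
by have /andP[_ ?] := le_cumulative mW Wb xy; lra.
Qed.

Lemma continuous_cumulative (W : set R) (b : R) : measurable W ->
  leb W = b%:E -> continuous (cumulative W).
Proof.
move=> mW Wb x; apply/cvgrPdist_lt => e e0; near=> y.
apply: (@le_lt_trans _ _ `|x - y|); last first.
  by near: y; exact: cvgr_dist_lt.
have [xy|/ltW yx] := leP x y.
  by have /andP[? ?] := le_cumulative mW Wb xy; rewrite !ler0_norm; lra.
by have /andP[? ?] := le_cumulative mW Wb yx; rewrite !ger0_norm; lra.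
Unshelve. all: by end_near. Qed.

(* With [rho v] the measure of [V] below [v], the hypotheses give
   [B v <= min ((1 + p) * rho v) (a + rho v)], and [rho] pushes the Lebesgue measure of
   [V] forward to that of [0, b]; the two bounds cross where [rho v = a / p]. *)
Lemma integral_ramp_le (V : set R) (B : R -> R) (l p a b c : R) :
  measurable V -> 0 <= c -> V `<=` `[l, l + c] ->
  leb V = b%:E -> leb (`[l, l + c] `\` V) = a%:E ->
  measurable_fun [set: R] B -> (forall x, 0 <= B x) -> 0 <= p ->
  (forall v, V v -> B v <= v - l) ->
  (forall v, V v -> `]v - B v / (1 + p), v] `<=` V) ->
  (\int[leb]_(v in V) (B v)%:E <= ((1 + p) * b ^+ 2 / 2)%:E)%E /\
  (0 < p -> a <= p * b ->
   (\int[leb]_(v in V) (B v)%:E <= (b ^+ 2 / 2 + a * b - a ^+ 2 / (2 * p))%:E)%E).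
Proof.
move=> mV c0 Vlc Vb Ua mB B0 p0 Bl BV.
have p10 : 0 < 1 + p by lra.
have b0 : 0 <= b by rewrite -lee_fin -Vb.
have a0 : 0 <= a by rewrite -lee_fin -Ua.
have mI (i : interval R) : measurable (V `&` [set` i]) by exact: measurableI.
have slope v : V v -> B v <= (1 + p) * cumulative V v.
  move=> Vv; rewrite mulrC -ler_pdivrMr// -lee_fin -(cumulativeE _ mV Vb).
  have : leb `]v - B v / (1 + p), v] = (B v / (1 + p))%:E.
    rewrite lebesgue_measure_itv/= lte_fin ltrBlDr ltrDl.
    case: ltgtP (divr_ge0 (B0 v) (ltW p10)) => // [_ _|<- _//].
    by rewrite -EFinB; congr EFin; ring.
  move=> <-; apply: le_measure; rewrite ?inE//; try exact: mI.
  by move=> x xv; split; [exact: BV xv|move: xv; rewrite /= !in_itv/= => /andP[]].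
(* [[l, v]] is covered by the part of [V] below [v] and by the complement of [V], of measure [a]. *)
have shift v : V v -> B v <= a + cumulative V v.
  move=> Vv; apply: (le_trans (Bl _ Vv)).
  rewrite -lee_fin [leRHS]EFinD -(cumulativeE _ mV Vb) -Ua.
  have /= := Vlc _ Vv; rewrite in_itv/= => /andP[lv vc].
  have : leb `[l, v] = (v - l)%:E.
    by rewrite lebesgue_measure_itv/= lte_fin; case: ltgtP lv => // -> _; rewrite subrr.
  move=> <-; have mU : measurable (`[l, l + c] `\` V) by exact: measurableD.
  apply: (le_trans _ (measureU2 leb mU (mI _))); apply: le_measure; rewrite ?inE//; try exact: mI.
    by apply: measurableU => //; exact: mI.
  move=> x; rewrite /= !in_itv/= => /andP[lx xv].
  by have [Vx|Vx] := pselect (V x); [right|left; rewrite lx (le_trans xv vc)].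
(* Stated for an initial segment [W] of [V], as it serves both for all of [V] and for its part below
   the crossing point. *)
have int_slope (W : set R) (k : R) : measurable W -> leb W = k%:E -> W `<=` V ->
    (forall v, W v -> V `&` `]-oo, v] = W `&` `]-oo, v]) ->
    (\int[leb]_(v in W) (B v)%:E <= ((1 + p) * k ^+ 2 / 2)%:E)%E.
  move=> {mI} mW Wk WV WE; rewrite -mulrA EFinM -(integral_cumulative mW Wk).
  rewrite -ge0_integralZl_EFin//; last 3 first.
  - by move=> x _; rewrite lee_fin fine_ge0.
  - have mc := measurable_cumulative mW Wk.
    by apply/measurable_EFinP; exact: measurable_funTS.
  - exact: ltW.
  apply: integral_le_nonmeasurable => v Wv; first by rewrite lee_fin.
  rewrite -EFinM lee_fin; apply: (le_trans (slope _ (WV _ Wv))).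
  by rewrite /cumulative WE.
split; first exact: int_slope.
move=> pp apb.
pose k := a / p.
have k0 : 0 <= k by rewrite divr_ge0.
have kb : k <= b by rewrite ler_pdivrMr// mulrC.
have cum_l : cumulative V l = 0.
  apply: EFin_inj; rewrite -(cumulativeE _ mV Vb).
  apply: (@subset_measure0 _ _ _ leb _ [set l]) => //; last exact: lebesgue_measure_set1.
  - exact: mI.
  - move=> x [/Vlc]; rewrite /= !in_itv/= => /andP[lx _] xl.
    by apply/eqP; rewrite eq_le xl.
have cum_r : cumulative V (l + c) = b.
  apply: EFin_inj; rewrite -(cumulativeE _ mV Vb) -Vb; congr (leb _).
  by apply: setIidl => x /Vlc; rewrite /= !in_itv/= => /andP[].
(* Continuity of the cumulative measure allows cutting [V] at exactly the mass where the two bounds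
   cross. *)
have [z _ zk] : exists2 z, z \in `[l, l + c] & cumulative V z = k.
  apply: IVT; first by rewrite lerDl.
    exact/continuous_subspaceT/(continuous_cumulative mV Vb).
  by rewrite cum_l cum_r ge_min k0 le_max kb orbT.
pose W1 := V `&` `]-oo, z].
pose W2 := V `&` `]z, +oo[.
have mW1 : measurable W1 by exact: mI.
have mW2 : measurable W2 by exact: mI.
have VW : V = W1 `|` W2 by rewrite -setIUr -itv_bndbnd_setU// set_itvNyy setIT.
have W12 : W1 `&` W2 = set0.
  rewrite -subset0 => x [[_ +] [_]]; rewrite /= !in_itv/= andbT => xz.
  by rewrite ltNge xz.
have W1k : leb W1 = k%:E by rewrite (cumulativeE _ mV Vb) zk.
have W2k : leb W2 = (b - k)%:E.
  have := measureU leb mW1 mW2 W12; rewrite /= -VW Vb W1k.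
  by case: (leb W2) => [r|//|//] [->]; congr EFin; ring.
have -> : (\int[leb]_(v in V) (B v)%:E = \int[leb]_(v in W1 `|` W2) (B v)%:E)%E.
  by rewrite -VW.
rewrite ge0_integral_setU//; last 3 first.
- exact/measurable_EFinP/measurable_funTS.
- by move=> x _; rewrite lee_fin.
- exact/disj_set2P.
have i1 : (\int[leb]_(v in W1) (B v)%:E <= ((1 + p) * k ^+ 2 / 2)%:E)%E.
  apply: int_slope => // [v []//|v [_]]; rewrite /= in_itv/= => vz.
  rewrite /W1 -setIA; congr (_ `&` _); apply/esym/setIidr => x /=.
  by rewrite !in_itv/= => /le_trans; exact.
(* Above the cut, [cumulative V] is [k] plus [cumulative W2], so the second bound integrates to a
   rectangle and a triangle. *)
have i2 : (\int[leb]_(v in W2) (B v)%:E <= ((a + k) * (b - k) + (b - k) ^+ 2 / 2)%:E)%E.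
  have -> : ((a + k) * (b - k) + (b - k) ^+ 2 / 2)%:E =
      (\int[leb]_(v in W2) ((a + k)%:E + (cumulative W2 v)%:E))%E.
    rewrite ge0_integralD//.
    - by rewrite integral_cst// [X in (_ * X)%E]W2k (integral_cumulative mW2 W2k).
    - by move=> v _; rewrite lee_fin addr_ge0.
    - by move=> v _; rewrite lee_fin fine_ge0.
    - have mc := measurable_cumulative mW2 W2k.
      by apply/measurable_EFinP; exact: measurable_funTS.
  apply: integral_le_nonmeasurable => v [Vv vz]; first by rewrite lee_fin.
  rewrite -EFinD lee_fin -addrA; apply: (le_trans (shift _ Vv)); rewrite lerD2l.
  rewrite -lee_fin EFinD -(cumulativeE _ mV Vb) -(cumulativeE _ mW2 W2k) -W1k.
  rewrite [leLHS](_ : _ = leb (W1 `|` (W2 `&` `]-oo, v]))).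
    by apply: measureU2 => //; exact: measurableI.
  congr (leb _); apply/seteqP; split => x.
    by rewrite {1}VW => -[[|W2x xv]]; [left|right].
  move=> [[Vx xz]|[[Vx _] xv]]; split => //.
  move: xz vz; rewrite /= !in_itv/= andbT => xz zv.
  exact: le_trans xz (ltW zv).
apply: (le_trans (leeD i1 i2)); rewrite -EFinD lee_fin.
have pk : p * k = a by rewrite mulrC divfK// gt_eqF.
have -> : a ^+ 2 / (2 * p) = a * k / 2.
  by rewrite /k; field; rewrite gt_eqF.
have : p * k ^+ 2 = a * k by rewrite -pk; ring.
lra.
Qed.

End Ramp.

(** * Overlapping windows *)

Section Overlap.
Context {R : realType}.
Local Notation leb := (@lebesgue_measure R).

(* For [0 <= g 0] the window of 0 is [- g 0, 0], [clamp (g 0)] is the projection onto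
   it, and [overlap g t] is the length of its intersection with the window of [t]. *)
Definition clamp (c x : R) : R := Num.max (- c) (Num.min 0 x).

Lemma clamp_itv c x : 0 <= c -> - c <= clamp c x <= 0.
Proof.
move=> c0; rewrite /clamp le_max ge_max lexx/= oppr_le0 c0/=.
by rewrite ge_min lexx.
Qed.

Lemma clamp_id c x : - c <= x -> x <= 0 -> clamp c x = x.
Proof. by move=> cx x0; rewrite /clamp min_r// max_r. Qed.

Lemma clamp_ge c x : x <= 0 -> x <= clamp c x.
Proof. by move=> x0; rewrite /clamp le_max le_min lexx x0 orbT. Qed.

Lemma clamp_le c x : - c <= x -> clamp c x <= x.
Proof. by move=> cx; rewrite /clamp ge_max cx/= ge_min lexx orbT. Qed.

Lemma clamp_top c x : 0 <= c -> 0 <= x -> clamp c x = 0.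
Proof. by move=> c0 x0; rewrite /clamp min_l// max_r// oppr_le0. Qed.

Lemma clamp_bottom c x : x <= - c -> clamp c x = - c.
Proof. by move=> xc; rewrite /clamp max_l// ge_min xc orbT. Qed.

Lemma le_clamp c x y : x <= y -> clamp c x <= clamp c y.
Proof. by move=> xy; apply: le_max2; rewrite // le_min2. Qed.

Lemma measurable_clamp c : measurable_fun [set: R] (clamp c).
Proof. by apply: measurable_maxr => //; exact: measurable_minr. Qed.

Definition overlap (g : R -> R) (t : R) : R :=
  `|clamp (g 0) t - clamp (g 0) (t - g t)|.

(** [clamp] is monotone and fixes the window of 0, so a common point lies between the projections of
    [t] and [t - g t]. *)
Lemma integral_common_window_le (g : R -> R) (t : R) : 0 <= g 0 ->
  (\int[leb]_s ((between_delayed g 0 s)%:R * (between_delayed g t s)%:R)%:E <=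
   (overlap g t)%:E)%E.
Proof.
move=> g0; rewrite /overlap; pose u := clamp (g 0) t; pose v := clamp (g 0) (t - g t).
have uv : leb `[Num.min u v, Num.max u v] = `|u - v|%:E.
  rewrite lebesgue_measure_itv/= lte_fin minEle maxEle.
  have [uv|vu] := leP u v.
    rewrite ler0_norm ?subr_le0// opprB.
    by case: ltgtP uv => // -> _; rewrite subrr.
  by rewrite vu -EFinB gtr0_norm// subr_gt0.
rewrite -uv -[X in leb X]setIT -integral_indic//.
apply: integral_le_nonmeasurable => s _; first by rewrite lee_fin mulr_ge0.
rewrite lee_fin -natrM mulnb indicE ler_nat.
have [/andP[b0 bt]|//] := boolP (_ && _).
rewrite lt0b inE/= in_itv/=.
move: b0; rewrite /between_delayed sub0r min_r ?oppr_le0// max_l ?oppr_le0//.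
move=> /andP[s0 s1]; rewrite -(clamp_id s0 s1).
rewrite /between_delayed !ge_min !le_max in bt; case/andP: bt => h1 h2.
by rewrite ge_min [X in _ && X]le_max; apply/andP; split; [case/orP: h1|case/orP: h2] => h;
  have := le_clamp (g 0) h; rewrite -?/u -?/v => ->; rewrite ?orbT.
Qed.

Lemma overlap_ge0 (g : R -> R) t : 0 <= overlap g t.
Proof. exact: normr_ge0. Qed.

Lemma measurable_overlap (g : R -> R) : measurable_fun [set: R] g ->
  measurable_fun [set: R] (overlap g).
Proof.
move=> mg; apply: measurableT_comp => //.
apply: measurable_funB; first exact: measurable_clamp.
by apply: measurableT_comp; [exact: measurable_clamp|exact: measurable_funB].
Qed.

Lemma overlap_le (g : R -> R) t : 0 <= g 0 -> overlap g t <= g 0.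
Proof.
move=> g0; rewrite ler_norml.
have := clamp_itv t g0; have := clamp_itv (t - g t) g0.
by move=> /andP[? ?] /andP[? ?]; apply/andP; split; lra.
Qed.

(** The window of [t] has to bridge the gap [[0, t]] first, which leaves at most [mu - t]. In
    [overlap_left] the gap is [[t, - g 0]]. *)
Lemma overlap_right (g : R -> R) mu t : 0 <= g 0 -> g t <= mu -> 0 <= t ->
  overlap g t <= Num.max 0 (mu - t).
Proof.
move=> g0 gmu t0; rewrite /overlap (clamp_top g0 t0) sub0r normrN.
have [d0|/ltW d0] := leP 0 (t - g t).
  by rewrite (clamp_top g0 d0) normr0 le_max lexx.
have /andP[_ h] := clamp_itv (t - g t) g0; have h' := clamp_ge (g 0) d0.
by rewrite ler0_norm// le_max; apply/orP; right; lra.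
Qed.

Lemma overlap_left (g : R -> R) mu t : 0 <= g 0 -> - mu <= g t -> t <= - g 0 ->
  overlap g t <= Num.max 0 (t + mu + g 0).
Proof.
move=> g0 gmu t0; rewrite /overlap (clamp_bottom t0) distrC opprK.
have [d0|/ltW d0] := leP (t - g t) (- g 0).
  by rewrite (clamp_bottom d0) addNr normr0 le_max lexx.
have /andP[h _] := clamp_itv (t - g t) g0; have h' := clamp_le d0.
by rewrite ger0_norm; [rewrite le_max; apply/orP; right|]; lra.
Qed.

(** The window of [t] extends to the left, so the overlap fits between [- g 0] and [t] as well as in
    the length [g t]. For [integral_ramp_le], the first bound gives the distance hypothesis and the
    second the run of points inside the set. *)
Lemma overlap_nonneg_delay (g : R -> R) t : 0 <= g 0 ->
  - g 0 <= t -> t <= 0 -> 0 <= g t -> overlap g t <= t + g 0 /\ overlap g t <= g t.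
Proof.
move=> g0 ct t0 gt; rewrite /overlap (clamp_id ct t0).
have d0 : t - g t <= 0 by lra.
have h' := clamp_ge (g 0) d0; have /andP[h _] := clamp_itv (t - g t) g0.
have : clamp (g 0) (t - g t) <= clamp (g 0) t by apply: le_clamp; lra.
by rewrite (clamp_id ct t0) => ?; rewrite ger0_norm; [split|]; lra.
Qed.

Lemma overlap_neg_delay (g : R -> R) t : 0 <= g 0 ->
  - g 0 <= t -> t <= 0 -> g t < 0 -> overlap g t <= - t /\ overlap g t <= - g t.
Proof.
move=> g0 ct t0 gt; rewrite /overlap (clamp_id ct t0).
have d0 : - g 0 <= t - g t by lra.
have h' := clamp_le d0; have /andP[_ h] := clamp_itv (t - g t) g0.
have : clamp (g 0) t <= clamp (g 0) (t - g t) by apply: le_clamp; lra.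
by rewrite (clamp_id ct t0) => ?; rewrite ler0_norm; [split|]; lra.
Qed.

(** [a] and [b] stand for the lengths of the parts of the window with negative and nonnegative
    delay. The slack is [(a - b)^2 / 4 * (1 + 1 / p)], so an even split is the worst case. *)
Lemma two_ramps_le (p a b A B : R) : 1 <= p ->
  A <= b ^+ 2 / 2 + a * b - a ^+ 2 / (2 * p) ->
  B <= a ^+ 2 / 2 + b * a - b ^+ 2 / (2 * p) ->
  A + B <= 3 * (a + b) ^+ 2 / 4 - (a + b) ^+ 2 / (4 * p).
Proof.
move=> p1 hA hB.
have -> : 3 * (a + b) ^+ 2 / 4 - (a + b) ^+ 2 / (4 * p) =
    (b ^+ 2 / 2 + a * b - a ^+ 2 / (2 * p)) +
    (a ^+ 2 / 2 + b * a - b ^+ 2 / (2 * p)) +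
    ((a - b) ^+ 2 / 4 + (a - b) ^+ 2 / (4 * p)).
  by field; rewrite gt_eqF//; lra.
rewrite -[leLHS]addr0; apply: lerD; first exact: lerD.
by apply: addr_ge0; rewrite divr_ge0 ?sqr_ge0//; lra.
Qed.

(** With [p * y <= x] the set of measure [y] is exhausted no later than the crossing [x / p] of its
    ramp, which leaves it the slope bound alone. The slack has the factor
    [(x + y)^2 - 2 * (1 + p) * y^2], nonnegative since [(1 + p) * y <= x + y] and [1 <= p]. *)
Lemma short_ramp_le (p x y A B : R) : 1 <= p -> 0 <= x -> 0 <= y -> p * y <= x ->
  A <= (1 + p) * y ^+ 2 / 2 ->
  B <= x ^+ 2 / 2 + y * x - y ^+ 2 / (2 * p) ->
  A + B <= 3 * (x + y) ^+ 2 / 4 - (x + y) ^+ 2 / (4 * p).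
Proof.
move=> p1 x0 y0 pyx hA hB.
have -> : 3 * (x + y) ^+ 2 / 4 - (x + y) ^+ 2 / (4 * p) =
    ((1 + p) * y ^+ 2 / 2 + (x ^+ 2 / 2 + y * x - y ^+ 2 / (2 * p))) +
    (p - 1) / (4 * p) * ((x + y) ^+ 2 - 2 * (1 + p) * y ^+ 2).
  by field; rewrite gt_eqF//; lra.
rewrite -[leLHS]addr0; apply: lerD; first exact: lerD.
apply: mulr_ge0; first by rewrite divr_ge0 ?mulr_ge0//; lra.
have h1 : ((1 + p) * y) ^+ 2 <= (x + y) ^+ 2.
  by rewrite lerXn2r// ?nnegrE ?mulr_ge0 ?addr_ge0//; lra.
have h2 : 0 <= (1 + p) * (p - 1) * y ^+ 2.
  by rewrite mulr_ge0 ?sqr_ge0// mulr_ge0//; lra.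
lra.
Qed.

(** Every overlap here is at most [t + c] or at most [- t], and the larger of the two integrates to
    [3 * c^2 / 4]. Each sign set of [g] is given to [integral_ramp_le] with the other one as its
    complement, which produces the loss [c^2 / (4 * p)]. *)
Lemma integral_overlap_middle_le (g : R -> R) (p : R) : 1 <= p ->
  upper_lipschitz (1 + p) g -> 0 <= g 0 ->
  (\int[leb]_(t in `[(- g 0)%R, 0%R]) (overlap g t)%:E <=
   (3 * g 0 ^+ 2 / 4 - g 0 ^+ 2 / (4 * p))%:E)%E.
Proof.
move=> p1 gL; set c := g 0 => g0.
have mg := measurable_upper_lipschitz gL.
have mo := measurable_overlap mg.
have p0 : 0 <= p by lra.
have pp : 0 < p by lra.
have p10 : 0 < 1 + p by lra.
have o0 := overlap_ge0 g.
have oV t : - c <= t -> t <= 0 -> 0 <= g t ->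
    overlap g t <= t + c /\ overlap g t <= g t by exact: overlap_nonneg_delay.
have oU t : - c <= t -> t <= 0 -> g t < 0 ->
    overlap g t <= - t /\ overlap g t <= - g t by exact: overlap_neg_delay.
pose V := [set t : R | - c <= t <= 0 /\ 0 <= g t].
(* The set [g < 0] is reflected, because its ramp starts at the right end 0 while [integral_ramp_le]
   measures from the left end. *)
pose W := [set t : R | 0 <= t <= c /\ g (- t) < 0].
have mV : measurable V.
  have -> : V = `[- c, 0] `&` g @^-1` `[0, +oo[.
    by apply/seteqP; split=> x; rewrite /V/= !in_itv/= andbT.
  by apply: measurableI => //; rewrite -[_ @^-1` _]setTI; exact: mg.
have mU : measurable (`[- c, 0] `\` V) by exact: measurableD.
have WE : W = -%R @^-1` (`[- c, 0] `\` V).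
  apply/seteqP; split=> x; rewrite /W /V/= in_itv/= oppr_le0 lerN2.
    move=> [/andP[x0 xc] gx]; split; first by rewrite x0 xc.
    by move=> [_]; rewrite leNgt gx.
  move=> [/andP[xc x0] nV]; split; first by rewrite x0 xc.
  by rewrite ltNge; apply/negP => gx; apply: nV; split=> //; apply/andP.
have WE' : `[0, 0 + c] `\` W = -%R @^-1` V.
  apply/seteqP; split=> x; rewrite /W /V/= in_itv/= oppr_le0 lerN2 add0r.
    move=> [/andP[x0 xc] nW]; split; first by rewrite x0 xc.
    by rewrite leNgt; apply/negP => gx; apply: nW; split=> //; apply/andP.
  move=> [/andP[xc x0] gx]; split; first by rewrite x0 xc.
  by move=> [_]; rewrite ltNge gx.
have mW : measurable W.
  by rewrite WE -[_ @^-1` _]setTI; apply: oppr_measurable.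
have fin (A : set R) : measurable A -> A `<=` `[- c, 0] -> leb A = (fine (leb A))%:E.
  move=> mA Ac; rewrite fineK// ge0_fin_numE//.
  apply: (@le_lt_trans _ _ (leb `[- c, 0])).
    by apply: le_measure; rewrite ?inE.
  rewrite lebesgue_measure_itv/=; case: ifP => _; exact: ltry.
pose b := fine (leb V).
pose a := fine (leb (`[- c, 0] `\` V)).
have Vb : leb V = b%:E by apply: fin => // x [].
have Ua : leb (`[- c, 0] `\` V) = a%:E by apply: fin => // x [].
have Wa : leb W = a%:E by rewrite WE -Ua; exact: lebesgue_measureN.
have Wb : leb (`[0, 0 + c] `\` W) = b%:E.
  by rewrite WE' -Vb; exact: lebesgue_measureN.
have b0 : 0 <= b by exact: fine_ge0.
have a0 : 0 <= a by exact: fine_ge0.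
have abc : a + b = c.
  have VU : V `|` (`[- c, 0] `\` V) = `[- c, 0]%classic.
    by apply: setDUK => x [].
  have := measureU leb mV mU; rewrite setDIK => /(_ erefl)/=.
  rewrite VU Vb Ua lebesgue_measure_itv/= lte_fin.
  case: ifPn => [_ [h]|]; first lra.
  by rewrite -leNgt => c0 [h]; lra.
have mo' : measurable_fun [set: R] (fun t => overlap g (- t)).
  by apply: measurableT_comp => //; exact: oppr_measurable.
have [V1 V2] : (\int[leb]_(v in V) (overlap g v)%:E <= ((1 + p) * b ^+ 2 / 2)%:E)%E /\
    (0 < p -> a <= p * b ->
     (\int[leb]_(v in V) (overlap g v)%:E <= (b ^+ 2 / 2 + a * b - a ^+ 2 / (2 * p))%:E)%E).
  apply: (integral_ramp_le (l := - c) (c := c)) => //.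
  - by move=> x []; rewrite addNr.
  - by rewrite addNr.
  - by move=> v [/andP[cv v0] gv]; have [? ?] := oV v cv v0 gv; lra.
  (* Going left from [v], [g] loses at most [(1 + p) * (v - t) < overlap g v <= g v], so it stays
     nonnegative. *)
  - move=> v [/andP[cv v0] gv] t /=; rewrite in_itv/= => /andP[vt tv].
    have [h1 h2] := oV v cv v0 gv.
    have oo : overlap g v / (1 + p) <= overlap g v by rewrite ler_pdivrMr// ler_peMr//; lra.
    split; first by apply/andP; split; lra.
    have := gL _ _ tv; have : (1 + p) * (v - t) < overlap g v by rewrite mulrC -ltr_pdivlMr//; lra.
    by move=> ? ?; lra.
have [U1 U2] : (\int[leb]_(v in W) (overlap g (- v))%:E <= ((1 + p) * a ^+ 2 / 2)%:E)%E /\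
    (0 < p -> b <= p * a ->
     (\int[leb]_(v in W) (overlap g (- v))%:E <= (a ^+ 2 / 2 + b * a - b ^+ 2 / (2 * p))%:E)%E).
  have Wo t : W t -> overlap g (- t) <= t /\ overlap g (- t) <= - g (- t).
    move=> [/andP[t0 tc] gt]; rewrite -{2}(opprK t).
    by apply: oU; rewrite ?lerN2 ?oppr_le0.
  apply: (integral_ramp_le (l := 0) (c := c)) => //.
  - by move=> x []; rewrite add0r.
  - by move=> v /Wo[]; rewrite subr0.
  - move=> v Wv t /=; rewrite in_itv/= => /andP[vt tv].
    have [h1 h2] := Wo _ Wv; case: Wv => /andP[v0 vc] gv.
    have oo : overlap g (- v) / (1 + p) <= overlap g (- v) by rewrite ler_pdivrMr// ler_peMr//; lra.
    split; first by apply/andP; split; lra.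
    have vt' : - v <= - t by rewrite lerN2.
    have := gL _ _ vt'.
    have : (1 + p) * (- t - - v) < overlap g (- v) by rewrite mulrC -ltr_pdivlMr//; lra.
    by move=> ? ?; lra.
have mEo D : measurable_fun D (EFin \o overlap g).
  exact/measurable_EFinP/measurable_funTS.
have oUW : (\int[leb]_(v in `[(- c)%R, 0%R]%classic `\` V) (overlap g v)%:E =
    \int[leb]_(v in W) (overlap g (- v)%R)%:E)%E.
  rewrite integral_mkcond [RHS]integral_mkcond -integral_opp; last 2 first.
  - by apply/(measurable_restrictT _ _).1; [exact: mU|exact: mEo].
  - by move=> x; rewrite patchE; case: ifP => // _; rewrite lee_fin.
  by apply: eq_integral => x _; rewrite !patchE WE.
have VU : V `|` (`[- c, 0] `\` V) = `[- c, 0]%classic by apply: setDUK => x [].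
rewrite -VU ge0_integral_setU//; last 3 first.
- exact: mEo.
- by move=> x _; rewrite lee_fin.
- by apply/disj_set2P; exact: setDIK.
rewrite oUW -abc.
have fin_le (D : set R) (f : R -> R) (k : R) : (forall x, 0 <= f x) ->
    (\int[leb]_(x in D) (f x)%:E <= k%:E)%E ->
    exists2 r, (\int[leb]_(x in D) (f x)%:E = r%:E)%E & r <= k.
  move=> f0; have : (0 <= \int[leb]_(x in D) (f x)%:E)%E.
    by apply: integral_ge0 => x _; rewrite lee_fin.
  by case: (\int[leb]_(x in D) _)%E => [r _ rk|//|//]; exists r.
have [ab|/ltW ba] := leP a (p * b).
  have [r1 -> h1] := fin_le _ _ _ o0 (V2 pp ab).
  have [ba|/ltW ab'] := leP b (p * a).
    have [r2 -> h2] := fin_le _ _ _ (fun x => o0 (- x)) (U2 pp ba).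
    by rewrite -EFinD lee_fin; exact: two_ramps_le.
  have [r2 -> h2] := fin_le _ _ _ (fun x => o0 (- x)) U1.
  by rewrite -EFinD lee_fin addrC [a + b]addrC; exact: short_ramp_le.
have ba' : b <= p * a.
  have h1 := ler_peMl b0 p1; have h2 := ler_peMl a0 p1; lra.
have [r1 -> h1] := fin_le _ _ _ o0 V1.
have [r2 -> h2] := fin_le _ _ _ (fun x => o0 (- x)) (U2 pp ba').
by rewrite -EFinD lee_fin; exact: short_ramp_le.
Qed.

(** Equality holds at [c = mu], where the coefficient is [2 - 1/4 - 1/(4p)]; the difference has the
    factor [mu - c]. *)
Lemma overlap_profile_le (mu p c : R) : 1 <= p -> 0 <= c -> c <= mu ->
  2 * c * mu - c ^+ 2 / 4 - c ^+ 2 / (4 * p) <=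
  mu ^+ 2 * ((7 * p - 1) / (4 * p)).
Proof.
move=> p1 c0 cmu.
have -> : mu ^+ 2 * ((7 * p - 1) / (4 * p)) =
   2 * c * mu - c ^+ 2 / 4 - c ^+ 2 / (4 * p) +
   (mu - c) * ((2 * mu - (mu + c) / 2) + (p - 1) / (4 * p) * (mu + c)).
  by field; rewrite gt_eqF//; lra.
rewrite lerDl; apply: mulr_ge0; first lra.
by apply: addr_ge0; [|apply: mulr_ge0; [rewrite divr_ge0 ?mulr_ge0//|]]; lra.
Qed.

(** On each side of the window of 0 the overlap is at most [c] and at most the remaining reach,
    which makes a rectangle [c * (mu - c)] and a triangle [c^2 / 2]. *)
Lemma integral_overlap_le0 (g : R -> R) (mu p : R) : 1 <= p ->
  (forall x, `|g x| <= mu) -> upper_lipschitz (1 + p) g -> 0 <= g 0 ->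
  (\int[leb]_t (overlap g t)%:E <= (mu ^+ 2 * ((7 * p - 1) / (4 * p)))%:E)%E.
Proof.
move=> p1 gmu gL g0.
have mo := measurable_overlap (measurable_upper_lipschitz gL).
have middle := integral_overlap_middle_le p1 gL g0.
have o0 := overlap_ge0 g.
have oc t := @overlap_le g t g0.
have gmu' x : - mu <= g x /\ g x <= mu by apply/andP; rewrite -ler_norml.
have oP t := overlap_right g0 (proj2 (gmu' t)).
have oN t := overlap_left g0 (proj1 (gmu' t)).
have [_ cmu] := gmu' 0.
move: middle oc oN cmu; set c := g 0 in g0 * => middle oc oN cmu.
apply: le_trans (_ : _ <= (2 * c * mu - c ^+ 2 / 4 - c ^+ 2 / (4 * p))%:E)%E _; last first.
  by rewrite lee_fin; exact: overlap_profile_le.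
clear gL gmu gmu'.
have tail0 (t m : R) : m <= 0 -> overlap g t <= Num.max 0 m -> overlap g t = 0.
  by move=> m0 om; apply/eqP; rewrite eq_le o0 andbT (le_trans om)// ge_max lexx.
rewrite (@integral_support _ (overlap g) (- c - mu) mu); last 2 first.
- by move=> x xl; apply: (tail0 _ (x + mu + c)); [|apply: oN]; lra.
- by move=> x xl; apply: (tail0 _ (mu - x)); [|apply: oP]; lra.
rewrite (@integral_split _ (overlap g) (- c - mu) (- mu) mu)//; [|lra|lra].
rewrite (@integral_split _ (overlap g) (- mu) (- c) mu)//; [|lra|lra].
rewrite (@integral_split _ (overlap g) (- c) 0 mu)//; [|lra|lra].
rewrite (@integral_split _ (overlap g) 0 (mu - c) mu)//; [|lra|lra].
have i1 : (\int[leb]_(x in `[(- c - mu)%R, (- mu)%R]) (overlap g x)%:E <=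
    (1 * ((- mu) ^+ 2 - (- c - mu) ^+ 2) / 2 + (mu + c) * (- mu - (- c - mu)))%R%:E)%E.
  apply: integral_le_affine => //; first lra.
  move=> x x1 x2; rewrite o0/= mul1r addrA; apply: (le_trans (oN x _)); first lra.
  by rewrite ge_max lexx andbT; lra.
have i2 : (\int[leb]_(x in `[(- mu)%R, (- c)%R]) (overlap g x)%:E <=
    (0 * ((- c) ^+ 2 - (- mu) ^+ 2) / 2 + c * (- c - - mu))%R%:E)%E.
  apply: integral_le_affine => //; first lra.
  by move=> x x1 x2; rewrite o0/= mul0r add0r.
have i3 : (\int[leb]_(x in `[0%R, (mu - c)%R]) (overlap g x)%:E <=
    (0 * ((mu - c) ^+ 2 - 0 ^+ 2) / 2 + c * (mu - c - 0))%R%:E)%E.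
  apply: integral_le_affine => //; first lra.
  by move=> x x1 x2; rewrite o0/= mul0r add0r.
have i4 : (\int[leb]_(x in `[(mu - c)%R, mu]) (overlap g x)%:E <=
    (-1 * (mu ^+ 2 - (mu - c) ^+ 2) / 2 + mu * (mu - (mu - c)))%R%:E)%E.
  apply: integral_le_affine => //; first lra.
  move=> x x1 x2; rewrite o0/= mulN1r addrC; apply: (le_trans (oP x _)); first lra.
  by rewrite ge_max lexx andbT; lra.
apply: (le_trans (leeD i1 (leeD i2 (leeD middle (leeD i3 i4))))).
by rewrite -!EFinD lee_fin; lra.
Qed.

End Overlap.

(** * Tonelli and Cauchy-Schwarz *)

Section Schur.
Context {R : realType}.
Local Notation leb := (@lebesgue_measure R).

Lemma integral2_shift (F : R * R -> R) (c : R) : measurable_fun [set: R * R] F ->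
  (forall z, 0 <= F z) ->
  (\int[leb]_x \int[leb]_y (F (x, y))%:E =
   \int[leb]_x \int[leb]_y (F ((x + c)%R, (y + c)%R))%:E)%E.
Proof.
move=> mF F0.
have mEF : measurable_fun [set: R * R] (EFin \o F) by exact/measurable_EFinP.
have F0' z : (0 <= (EFin \o F) z)%E by rewrite lee_fin.
rewrite -(@integral_shift _ (fun x => \int[leb]_y (F (x, y))%:E)%E c); last 2 first.
- exact: (measurable_fun_fubini_tonelli_F (m2 := leb) _ mEF F0').
- by move=> x; apply: integral_ge0 => y _; exact: F0'.
apply: eq_integral => x _.
rewrite -(@integral_shift _ (fun y => (F (x + c, y))%:E) c)//; last by move=> y; rewrite lee_fin.
apply/measurable_EFinP; apply: (measurableT_comp mF).
exact: pair1_measurable.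
Qed.

Lemma integral2_opp (F : R * R -> R) : measurable_fun [set: R * R] F ->
  (forall z, 0 <= F z) ->
  (\int[leb]_x \int[leb]_y (F (x, y))%:E =
   \int[leb]_x \int[leb]_y (F ((- x)%R, (- y)%R))%:E)%E.
Proof.
move=> mF F0.
have mEF : measurable_fun [set: R * R] (EFin \o F) by exact/measurable_EFinP.
have F0' z : (0 <= (EFin \o F) z)%E by rewrite lee_fin.
rewrite -(@integral_opp _ (fun x => \int[leb]_y (F (x, y))%:E)%E); last 2 first.
- exact: (measurable_fun_fubini_tonelli_F (m2 := leb) _ mEF F0').
- by move=> x; apply: integral_ge0 => y _; exact: F0'.
apply: eq_integral => x _.
rewrite -(@integral_opp _ (fun y => (F (- x, y))%:E))//; last by move=> y; rewrite lee_fin.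
apply/measurable_EFinP; apply: (measurableT_comp mF).
exact: pair1_measurable.
Qed.

Lemma integral_overlap_le (g : R -> R) (mu p x0 : R) : 1 <= p ->
  (forall x, `|g x| <= mu) -> upper_lipschitz (1 + p) g ->
  (\int[leb]_t \int[leb]_s
     ((between_delayed g x0 s)%:R * (between_delayed g t s)%:R)%:E <=
   (mu ^+ 2 * ((7 * p - 1) / (4 * p)))%:E)%E.
Proof.
move=> p1 gmu gL.
have core (k : R -> R) : (forall x, `|k x| <= mu) -> upper_lipschitz (1 + p) k ->
    0 <= k 0 -> (\int[leb]_t \int[leb]_s
     ((between_delayed k 0 s)%:R * (between_delayed k t s)%:R)%:E <=
    (mu ^+ 2 * ((7 * p - 1) / (4 * p)))%:E)%E.
  move=> kmu kL k0; apply: le_trans (integral_overlap_le0 p1 kmu kL k0).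
  apply: integral_le_nonmeasurable => t _; last exact: integral_common_window_le.
  by apply: integral_ge0 => s _; rewrite lee_fin mulr_ge0.
have mbb (k : R -> R) c : upper_lipschitz (1 + p) k -> measurable_fun [set: R * R]
    (fun z => (between_delayed k c z.2)%:R * (between_delayed k z.1 z.2)%:R : R).
  move=> /measurable_upper_lipschitz mk.
  by apply: measurable_funM; exact: measurable_between_delayed.
pose k x := g (x + x0).
have kL : upper_lipschitz (1 + p) k by exact: upper_lipschitz_shift.
have -> : (\int[leb]_t \int[leb]_s
     ((between_delayed g x0 s)%:R * (between_delayed g t s)%:R)%:E =
   \int[leb]_t \int[leb]_s
     ((between_delayed k 0 s)%:R * (between_delayed k t s)%:R)%:E)%E.
  rewrite (@integral2_shift _ x0 (mbb g x0 gL)); last by move=> z; rewrite mulr_ge0.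
  apply: eq_integral => t _; apply: eq_integral => s _ /=.
  by rewrite !between_delayed_shift add0r.
have [k0|/ltW k0] := leP 0 (k 0); first by apply: core => // x; exact: gmu.
rewrite (@integral2_opp _ (mbb k 0 kL)); last by move=> z; rewrite mulr_ge0.
have := core (fun x => - k (- x)).
under eq_integral do under eq_integral do rewrite !between_delayed_opp oppr0.
apply; [|exact: upper_lipschitz_opp|by rewrite /= oppr0 oppr_ge0].
by move=> x; rewrite normrN; exact: gmu.
Qed.

Lemma schur_bound (g C w Z : R -> R) (K : R) : measurable_fun [set: R] g ->
  measurable_fun [set: R] C -> measurable_fun [set: R] w ->
  measurable_fun [set: R] Z ->
  (forall x, 0 <= C x) -> (forall x, 0 <= Z x) ->
  (forall s, \int[leb]_x (C x * (between_delayed g x s)%:R)%:E <= (K * w s)%:E)%E ->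
  (\int[leb]_x \int[leb]_s (C x * (between_delayed g x s)%:R * Z s)%:E <=
   \int[leb]_s (K * w s * Z s)%:E)%E.
Proof.
move=> mg mC mw mZ C0 Z0 hC.
have mF : measurable_fun [set: R * R]
    (fun z => (C z.1 * (between_delayed g z.1 z.2)%:R * Z z.2)%:E).
  apply/measurable_EFinP; apply: measurable_funM; last exact: measurableT_comp.
  apply: measurable_funM; first exact: measurableT_comp.
  exact: measurable_between_delayed.
have swap : (\int[leb]_x \int[leb]_s (C x * (between_delayed g x s)%:R * Z s)%:E =
    \int[leb]_s \int[leb]_x (C x * (between_delayed g x s)%:R * Z s)%:E)%E.
  apply: (fubini_tonelli (m1 := leb) (m2 := leb) _ mF) => z.
  by rewrite lee_fin !mulr_ge0.
rewrite swap.
apply: integral_le_nonmeasurable => s _.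
  by apply: integral_ge0 => x _; rewrite lee_fin !mulr_ge0.
under eq_integral do rewrite /= mulrC EFinM.
rewrite ge0_integralZl_EFin//; last 2 first.
- by move=> x _; rewrite lee_fin mulr_ge0.
- apply/measurable_EFinP; apply: measurable_funM => //.
  exact: measurable_between_delayed.
by rewrite [leRHS]EFinM [leRHS]muleC; apply: lee_wpmul2l; rewrite ?lee_fin.
Qed.

(** Discriminant of a quadratic in [l], tested at its minimiser [I / W]. For [W = 0] and [I]
    nonzero, the witness turns the left side into [q + 1], a contradiction. *)
Lemma sqr_le_of_quadratic (I W q : R) : 0 <= W ->
  (forall l, 2 * l * I <= l ^+ 2 * W + q) -> I ^+ 2 <= W * q.
Proof.
rewrite le_eqVlt => /predU1P[<-|W0] H.
  have [->|I0] := eqVneq I 0; first by rewrite expr0n mul0r.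
  have := H ((q + 1) / (2 * I)).
  rewrite mulr0 add0r (_ : 2 * _ * I = q + 1); first by move=> ?; lra.
  by field.
have := H (I / W); rewrite (_ : 2 * _ * I = 2 * (I ^+ 2 / W)); last by field; rewrite gt_eqF.
rewrite (_ : _ ^+ 2 * W = I ^+ 2 / W); last by field; rewrite gt_eqF.
by move=> h; rewrite mulrC -ler_pdivrMr//; lra.
Qed.

(** Integrate [(l * w - f)^2 / w >= 0] and optimise over [l]. The values 1 and -1 of [l] first give
    [|f| <= w + f^2 / w], hence the integrability of [f]. *)
Lemma weighted_cauchy_schwarz (D : set R) (f w : R -> R) (c q : R) : measurable D ->
  measurable_fun D f -> measurable_fun D w -> (forall x, 0 < w x) ->
  (\int[leb]_(x in D) (w x)%:E <= c%:E)%E ->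
  (\int[leb]_(x in D) (f x ^+ 2 / w x)%:E <= q%:E)%E ->
  (\int[leb]_(x in D) f x) ^+ 2 <= c * q.
Proof.
move=> mD mf mw w0 wc fq.
have mfw : measurable_fun D (fun x => f x ^+ 2 / w x).
  apply: measurable_funM; first exact: measurable_funX.
  rewrite [X in measurable_fun _ X](_ : _ = (fun x => w x `^ (-1))).
    exact: (measurableT_comp (measurable_powR (-1)) mw).
  by apply/funext => x; rewrite powR_inv1// ltW.
have fw0 x : 0 <= f x ^+ 2 / w x by rewrite divr_ge0 ?sqr_ge0// ltW.
have iw : leb.-integrable D (EFin \o w).
  apply/integrableP; split; first exact/measurable_EFinP.
  under eq_integral do rewrite /= ger0_norm ?ltW//.
  exact: le_lt_trans wc (ltry _).
have ifw : leb.-integrable D (EFin \o (fun x => f x ^+ 2 / w x)).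
  apply/integrableP; split; first exact/measurable_EFinP.
  under eq_integral do rewrite /= ger0_norm//.
  exact: le_lt_trans fq (ltry _).
have young (l x : R) : 2 * l * f x <= l ^+ 2 * w x + f x ^+ 2 / w x.
  rewrite -subr_ge0 (_ : _ - _ = (l * w x - f x) ^+ 2 / w x).
    by rewrite divr_ge0 ?sqr_ge0// ltW.
  by field; rewrite gt_eqF.
have isum (l : R) : leb.-integrable D (EFin \o (fun x => l ^+ 2 * w x + f x ^+ 2 / w x)).
  have := integrableD (mu := leb) mD (integrableZl (mu := leb) mD (l ^+ 2) iw) ifw.
  by apply: eq_integrable => // x _ /=; rewrite -EFinM -EFinD.
have iff : leb.-integrable D (EFin \o f).
  apply: le_integrable (isum 1) => //; first exact/measurable_EFinP.
  move=> x _ /=; rewrite lee_fin ler_norml.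
  have h1 := young 1 x; have h2 := young (-1) x.
  rewrite ger0_norm; last by rewrite addr_ge0// mulr_ge0 ?sqr_ge0 ?ltW.
  have := w0 x; have := fw0 x; rewrite sqrrN in h2.
  by move=> ? ?; apply/andP; split; lra.
pose W := \int[leb]_(x in D) w x.
pose Q := \int[leb]_(x in D) (f x ^+ 2 / w x).
have W0 : 0 <= W by apply: Rintegral_ge0 => x _; exact: ltW.
have Q0 : 0 <= Q by apply: Rintegral_ge0.
have Wc : W <= c by rewrite -lee_fin fineK//; exact: integrable_fin_num.
have Qq : Q <= q by rewrite -lee_fin fineK//; exact: integrable_fin_num.
apply: (@le_trans _ _ (W * Q)); last exact: ler_pM.
apply: sqr_le_of_quadratic => // l.
rewrite -RintegralZl// /W /Q -RintegralZl//.
rewrite -RintegralD//; last by have := integrableZl (mu := leb) mD (l ^+ 2) iw.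
apply: le_Rintegral => //.
by have := integrableZl (mu := leb) mD (2 * l) iff.
Qed.

End Schur.

(** * The energy estimate *)

Section Energy.
Context {R : realType}.
Local Notation leb := (@lebesgue_measure R).

Definition window (g : R -> R) (x : R) : set R :=
  `[Num.min x (x - g x), Num.max x (x - g x)].

Lemma window_between (g : R -> R) (x : R) (f : R -> \bar R) :
  (\int[leb]_(s in window g x) f s =
   \int[leb]_s ((between_delayed g x s)%:R%:E * f s))%E.
Proof.
rewrite integral_mkcond; apply: eq_integral => s _.
rewrite patchE mem_setE in_itv/= /between_delayed.
by case: ifP => _; rewrite ?mul1e ?mul0e.
Qed.

Lemma lebesgue_window (g : R -> R) (x : R) : leb (window g x) = `|g x|%:E.
Proof.
rewrite /window lebesgue_measure_itv/= lte_fin minEle maxEle.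
have [xg|xg] := leP x (x - g x).
  rewrite ler0_norm; last lra.
  case: ltgtP xg => // [_ _|e _]; first by rewrite -EFinD; congr EFin; ring.
  by congr EFin; lra.
by rewrite xg -EFinD gtr0_norm; [congr EFin; ring|lra].
Qed.

Lemma measurable_window (g : R -> R) (x : R) : measurable (window g x).
Proof. exact: measurable_itv. Qed.

(* Schur test: Cauchy-Schwarz on each window with weight [w], then Tonelli. *)
Lemma energy_le (I : finType) (f : I -> R -> R) (g C w : R -> R) (K e : R) :
  measurable_fun [set: R] g -> measurable_fun [set: R] C ->
  measurable_fun [set: R] w -> (forall i, measurable_fun [set: R] (f i)) ->
  (forall x, 0 <= C x) -> 0 <= K -> 0 < e -> (forall s, e <= w s) ->
  (forall x, \int[leb]_(s in window g x) (w s)%:E <= (C x)%:E)%E ->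
  (forall s, \int[leb]_x (C x * (between_delayed g x s)%:R)%:E <= (K * w s)%:E)%E ->
  (\int[leb]_s (\sum_i f i s ^+ 2)%:E < +oo)%E ->
  (\int[leb]_x (\sum_i (\int[leb]_(s in window g x) f i s) ^+ 2)%:E <=
   K%:E * \int[leb]_s (\sum_i f i s ^+ 2)%:E)%E.
Proof.
move=> mg mC mw mf C0 K0 e0 ew H1 H2 fin.
have w0 s : 0 < w s by exact: lt_le_trans (ew s).
pose Y s := \sum_i f i s ^+ 2.
have Y0 s : 0 <= Y s by apply: sumr_ge0 => i _; exact: sqr_ge0.
have mY : measurable_fun [set: R] Y.
  by apply: measurable_sum => i; exact: measurable_funX.
have mwV : measurable_fun [set: R] (fun s => (w s)^-1).
  rewrite [X in measurable_fun _ X](_ : _ = (fun x => w x `^ (-1))).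
    exact: (measurableT_comp (measurable_powR (-1)) mw).
  by apply/funext => x; rewrite powR_inv1// ltW.
have mfw i : measurable_fun [set: R] (fun s => f i s ^+ 2 / w s).
  by apply: measurable_funM => //; exact: measurable_funX.
have mYw : measurable_fun [set: R] (fun s => Y s / w s) by exact: measurable_funM.
have fw0 i s : 0 <= f i s ^+ 2 / w s by rewrite divr_ge0 ?sqr_ge0// ltW.
have Yw0 s : 0 <= Y s / w s by rewrite divr_ge0// ltW.
(* The bound [e <= w s] makes [f^2 / w] at most [e^-1] times the energy density, so the window
   integrals are finite. *)
have finw i x : (\int[leb]_(s in window g x) (f i s ^+ 2 / w s)%:E < +oo)%E.
  apply: (@le_lt_trans _ _ (e^-1%:E * \int[leb]_s (Y s)%:E)%E).
    rewrite -ge0_integralZl_EFin//; last 3 first.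
    - by move=> s _; rewrite lee_fin.
    - exact/measurable_EFinP.
    - by rewrite invr_ge0 ltW.
    rewrite window_between; apply: integral_le_nonmeasurable => s _.
      by rewrite mule_ge0 ?lee_fin.
    rewrite -!EFinM lee_fin.
    apply: (@le_trans _ _ (f i s ^+ 2 / w s)).
      by rewrite ler_piMl// lern1 leq_b1.
    rewrite mulrC ler_pM ?sqr_ge0 ?invr_ge0 ?(ltW (w0 _))//.
      by rewrite lef_pV2// posrE.
    by rewrite /Y (bigD1 i)//= lerDl sumr_ge0// => j _; exact: sqr_ge0.
  by rewrite lte_mul_pinfty// lee_fin invr_ge0 ltW.
(* Cauchy-Schwarz leaves [Y / w] on the windows; the factor [w] from the second Schur condition
   cancels the division. *)
have -> : (K%:E * \int[leb]_s (Y s)%:E = \int[leb]_s (K * w s * (Y s / w s))%:E)%E.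
  under [RHS]eq_integral => s _.
    rewrite (_ : K * w s * (Y s / w s) = K * Y s); last by field; rewrite gt_eqF.
    over.
  rewrite -ge0_integralZl_EFin//; last exact/measurable_EFinP.
  by move=> s _; rewrite lee_fin.
have sb := schur_bound mg mC mw mYw C0 Yw0 H2.
apply: le_trans sb.
apply: integral_le_nonmeasurable => x _.
  by rewrite lee_fin sumr_ge0// => i _; exact: sqr_ge0.
have -> : (\int[leb]_s (C x * (between_delayed g x s)%:R * (Y s / w s))%:E =
    (C x)%:E * \sum_i \int[leb]_(s in window g x) (f i s ^+ 2 / w s)%:E)%E.
  have mfwx i : measurable_fun (window g x) (fun s => (f i s ^+ 2 / w s)%:E).
    by apply/measurable_EFinP; exact: measurable_funTS.
  rewrite -(ge0_integral_sum leb (measurable_window g x) mfwx); last first.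
    by move=> i s _; rewrite lee_fin.
  rewrite window_between -ge0_integralZl_EFin//; last 2 first.
  - by move=> s _; rewrite mule_ge0 ?lee_fin// sume_ge0// => i _; rewrite lee_fin.
  - apply: emeasurable_funM.
      by apply/measurable_EFinP; exact: measurable_between_delayed.
    by apply: emeasurable_sum => i; apply/measurable_EFinP; exact: mfw.
  apply: eq_integral => s _; rewrite sumEFin -!EFinM; congr EFin.
  by rewrite -mulrA /Y mulr_suml.
have -> : (\sum_i \int[leb]_(s in window g x) (f i s ^+ 2 / w s)%:E =
    (\sum_i fine (\int[leb]_(s in window g x) (f i s ^+ 2 / w s)%:E))%:E)%E.
  rewrite -sumEFin; apply: eq_bigr => i _; rewrite fineK// ge0_fin_numE//.
  by apply: integral_ge0 => s _; rewrite lee_fin.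
rewrite -EFinM lee_fin mulr_sumr; apply: ler_sum => i _.
apply: (weighted_cauchy_schwarz (w := w)) => //.
- exact: measurable_window.
- exact: measurable_funTS.
- exact: measurable_funTS.
- rewrite fineK// ge0_fin_numE//.
  by apply: integral_ge0 => s _; rewrite lee_fin.
Qed.

Lemma calF_gt0 (p : R) : 0 <= p -> 0 < calF p.
Proof.
move=> p0; rewrite /calF; case: ifPn => [p1|]; first by apply: divr_gt0; lra.
by rewrite -leNgt => p1; apply: divr_gt0; lra.
Qed.

Lemma delay_energy_le (I : finType) (f : I -> R -> R) (g : R -> R) (mu p : R) :
  0 < mu -> 0 <= p -> (forall x, `|g x| <= mu) -> upper_lipschitz (1 + p) g ->
  (forall i, measurable_fun [set: R] (f i)) ->
  (\int[leb]_s (\sum_i f i s ^+ 2)%:E < +oo)%E ->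
  (\int[leb]_x (\sum_i (\int[leb]_(s in window g x) f i s) ^+ 2)%:E <=
   (mu ^+ 2 * calF p)%:E * \int[leb]_s (\sum_i f i s ^+ 2)%:E)%E.
Proof.
move=> mu0 p0 gmu gL mf fin.
have mg := measurable_upper_lipschitz gL.
have F0 := calF_gt0 p0.
have K0 : 0 < mu ^+ 2 * calF p by rewrite mulr_gt0// exprn_gt0.
have [p1|p1] := ltP p 1.
  apply: (@energy_le _ f g (fun x => `|g x|) (cst 1) _ 1) => //.
  - exact: measurableT_comp.
  - exact: ltW.
  - move=> x; rewrite [leLHS](_ : _ = 1%:E * leb (window g x))%E.
      by rewrite lebesgue_window mul1e.
    exact: (integral_cst leb (measurable_window g x) 1%:E).
  - move=> s; rewrite mulr1 /calF p1.
    exact: (integral_hit_time_le s mu0 p0 (ltW p1) gmu gL).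
pose b x s : R := (between_delayed g x s)%:R.
have b0 x s : 0 <= b x s by [].
have mb : measurable_fun [set: R * R] (fun z => b z.1 z.2).
  exact: measurable_between_delayed.
have mEb : measurable_fun [set: R * R] (fun z => (b z.1 z.2)%:E) by exact/measurable_EFinP.
pose N (s : R) : R := fine (\int[leb]_x (b x s)%:E).
have NE s : (\int[leb]_x (b x s)%:E = (N s)%:E)%E.
  rewrite fineK// ge0_fin_numE; last by apply: integral_ge0 => x _; rewrite lee_fin.
  apply: (@le_lt_trans _ _ (\int[leb]_x (\1_(`[(s - mu)%R, (s + mu)%R]%classic) x)%:E)%E).
    apply: integral_le_nonmeasurable => x _; first by rewrite lee_fin.
    rewrite lee_fin indicE ler_nat /between_delayed ge_min le_max.
    have [/andP[h1 h2]|//] := boolP (_ && _).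
    rewrite lt0b mem_setE in_itv/=.
    have : - mu <= g x <= mu by rewrite -ler_norml.
    by move=> /andP[? ?]; apply/andP; split; [case/orP: h2|case/orP: h1] => ?; lra.
  rewrite integral_indic//= setIT [X in (X < _)%E]lebesgue_measure_itv/=.
  by case: ifP => _; rewrite ltry.
have N0 s : 0 <= N s by apply: fine_ge0; apply: integral_ge0 => x _; rewrite lee_fin.
have mN : measurable_fun [set: R] N.
  apply: measurableT_comp; first exact: fine_measurable.
  apply: (measurable_fun_fubini_tonelli_G (m1 := leb) _ mEb) => z.
  by rewrite lee_fin.
have E0 : (0 <= \int[leb]_s (\sum_i f i s ^+ 2)%:E)%E.
  by apply: integral_ge0 => s _; rewrite lee_fin sumr_ge0// => i _; exact: sqr_ge0.
(* The weight is the measure of the set of windows through [s]; [e] keeps it away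
   from 0. *)
have key e : 0 < e -> (\int[leb]_x (\sum_i (\int[leb]_(s in window g x) f i s) ^+ 2)%:E <=
   (mu ^+ 2 * calF p + e * mu)%:E * \int[leb]_s (\sum_i f i s ^+ 2)%:E)%E.
  move=> e0.
  have C0 : 0 <= mu ^+ 2 * calF p + e * mu by rewrite addr_ge0 ?mulr_ge0 ?sqr_ge0// ltW.
  apply: (@energy_le _ f g (cst (mu ^+ 2 * calF p + e * mu)) (fun s => N s + e) _ e) => //.
  - exact: measurable_funD.
  - by move=> s; rewrite lerDr.
  - move=> x; under eq_integral do rewrite EFinD.
    rewrite ge0_integralD//; last 4 first.
    + exact: measurable_window.
    + by move=> s _; rewrite lee_fin.
    + by apply/measurable_EFinP; exact: measurable_funTS.
    + by move=> s _; rewrite lee_fin ltW.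
    rewrite integral_cst//; last exact: measurable_window.
    rewrite [X in (_ + _ * X)%E]lebesgue_window EFinD; apply: leeD; last first.
      by rewrite -EFinM lee_fin ler_wpM2l// ltW.
    rewrite window_between.
    have mb2 : measurable_fun [set: R * R] (fun z => (b x z.1 * b z.2 z.1)%:E).
      apply/measurable_EFinP; apply: measurable_funM.
        exact: measurable_between_delayed.
      exact: measurable_between_delayed.
    have -> : (\int[leb]_s ((b x s)%:E * (N s)%:E) =
        \int[leb]_s \int[leb]_t (b x s * b t s)%:E)%E.
      apply: eq_integral => s _; rewrite -NE -ge0_integralZl_EFin//; last first.
        by apply/measurable_EFinP; exact: measurable_between_delayed.
      by move=> t _; rewrite lee_fin.
    rewrite [leLHS](fubini_tonelli (m1 := leb) (m2 := leb) _ mb2); last first.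
      by move=> z; rewrite lee_fin mulr_ge0.
    rewrite /calF ltNge p1/=; exact: (integral_overlap_le x p1 gmu gL).
  - move=> s /=.
    rewrite (_ : (\int[leb]_x _)%E = ((mu ^+ 2 * calF p + e * mu)%:E * (N s)%:E)%E).
      by rewrite -EFinM lee_fin ler_wpM2l// lerDl ltW.
    rewrite -NE -ge0_integralZl_EFin//; last first.
      by apply/measurable_EFinP; exact: measurable_between_delayed.
    by move=> t _; rewrite lee_fin.
move: key E0 fin; case: (\int[leb]_s (\sum_i f i s ^+ 2)%:E)%E => [r|//|//] key.
rewrite lee_fin => r0 _.
(* [r] is the energy. The error becomes [e * r / (r + 1) <= e], and [r + 1] is nonzero even for
   [r = 0]. *)
apply/lee_addgt0Pr => e e0; have d0 : 0 < mu * (r + 1) by rewrite mulr_gt0//; lra.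
apply: (le_trans (key _ (divr_gt0 e0 d0))); rewrite -!EFinM -EFinD lee_fin mulrDl lerD2l.
have r1 : 0 < r + 1 by lra.
rewrite (_ : _ * r = e * (r / (r + 1))); last first.
  by field; rewrite !gt_eqF.
by rewrite ler_piMr ?ltW// ltr_pdivrMr// mul1r ltrDl.
Qed.

End Energy.

(** * The delay operator *)

Section DelayOperator.
Context {R : realType}.
Local Notation leb := (@lebesgue_measure R).

Lemma Rintegral_shift (f : R -> R) (a b c : R) : measurable_fun [set: R] f ->
  \int[leb]_(s in `[a, b]) f (s + c) = \int[leb]_(s in `[a + c, b + c]) f s.
Proof.
move=> mf; rewrite /Rintegral; congr fine.
rewrite integral_mkcond [RHS]integral_mkcond.
pose F := (EFin \o f) \_ `[a + c, b + c].
have mF : measurable_fun [set: R] F.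
  apply/(measurable_restrictT _ _).1; first exact: measurable_itv.
  exact/measurable_EFinP/measurable_funTS.
rewrite (_ : (_ \_ _) = F \o (fun x => x + c)); last first.
  by apply/funext => x; rewrite /F/= !patchE !mem_setE !in_itv/= !lerD2r.
rewrite integralE [RHS]integralE.
rewrite -(integral_shift c (measurable_funepos mF)); last first.
  by move=> x; exact: funepos_ge0.
rewrite -(integral_shift c (measurable_funeneg mF))//.
by congr (_ - _)%E; apply: eq_integral => x _; rewrite ?funeposE ?funenegE.
Qed.

Lemma oriented_int_sqr (a b : R) (f : R -> R) :
  oriented_int a b f ^+ 2 =
  (\int[leb]_(s in `[Num.min b a, Num.max b a]) f s) ^+ 2.
Proof.
rewrite /oriented_int; by case: (leP a b) => ab //; rewrite sqrrN.
Qed.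

Lemma euclid_norm_sqr n (v : 'cV[R[i]%C]_n) :
  euclid_norm v ^+ 2 =
  \sum_(k < n) (complex.Re (v k 0) ^+ 2 + complex.Im (v k 0) ^+ 2).
Proof.
rewrite /euclid_norm sqr_sqrtr; last by apply: sumr_ge0 => k _; exact: sqr_ge0.
apply: eq_bigr => k _; case: (v k 0) => x y /=.
by rewrite sqr_sqrtr// addr_ge0// sqr_ge0.
Qed.

Lemma L2norm_sqr n (v : R -> 'cV[R[i]%C]_n) :
  (L2norm v ^+ 2 = \int[leb]_(t in `[0%R, +oo[) (euclid_norm (v t) ^+ 2)%:E)%E.
Proof.
rewrite /L2norm; set x := (\int[_]_(_ in _) _)%E.
have : (0 <= x)%E by apply: integral_ge0 => t _; rewrite lee_fin sqr_ge0.
case: x => [r|_|//]; last by rewrite poweRyr ?mulyy//; lra.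
rewrite lee_fin => r0; rewrite poweR_EFin div1r powR12_sqrt//.
by rewrite -EFin_expe sqr_sqrtr.
Qed.

Lemma euclid_norm_u_of n (h mu p : R) (eta : R -> R) (y : R -> 'cV[R[i]%C]_n) (t : R) :
  0 <= calF p ->
  euclid_norm (u_of h mu p eta y t) ^+ 2 = (mu ^+ 2 * calF p)^-1 *
    \sum_(k < n)
     (oriented_int (- h - eta t) (- h) (fun s => complex.Re (y (t + s) k 0)) ^+ 2 +
      oriented_int (- h - eta t) (- h) (fun s => complex.Im (y (t + s) k 0)) ^+ 2).
Proof.
move=> F0; rewrite euclid_norm_sqr mulr_sumr; apply: eq_bigr => k _.
rewrite /u_of /oriented_vint !mxE.
set a := oriented_int _ _ _; set b := oriented_int _ _ _.
rewrite /= !mul0r subr0 addr0 mulrDr; congr (_ + _).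
  by rewrite exprMn sqrrN expr_div_n expr1n exprMn sqr_sqrtr// div1r.
by rewrite exprMn sqrrN expr_div_n expr1n exprMn sqr_sqrtr// div1r.
Qed.

(** Tonelli gives measurability in [x] for nonnegative integrands; a signed [f] is split into its
    positive and negative parts. *)
Lemma measurable_window_integral (g f : R -> R) : measurable_fun [set: R] g ->
  measurable_fun [set: R] f ->
  measurable_fun [set: R] (fun x => \int[leb]_(s in window g x) f s).
Proof.
move=> mg mf; apply: measurableT_comp; first exact: fine_measurable.
have nonneg (k : R -> \bar R) : measurable_fun [set: R] k -> (forall s, 0 <= k s)%E ->
    measurable_fun [set: R] (fun x => \int[leb]_(s in window g x) k s)%E.
  move=> mk k0; under eq_fun do rewrite window_between.
  apply: (measurable_fun_fubini_tonelli_F (m2 := leb)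
    (fun z => (between_delayed g z.1 z.2)%:R%:E * k z.2)%E).
    apply: emeasurable_funM; last exact: measurableT_comp.
    by apply/measurable_EFinP; exact: measurable_between_delayed.
  by move=> z; rewrite mule_ge0// lee_fin.
have mEf : measurable_fun [set: R] (EFin \o f) by exact/measurable_EFinP.
under eq_fun do rewrite integralE.
apply: emeasurable_funB; apply: nonneg.
- exact: measurable_funepos.
- by move=> s; exact: funepos_ge0.
- exact: measurable_funeneg.
- by move=> s; exact: funeneg_ge0.
Qed.

Lemma delay_upper_lipschitz (p : R) (tau : R -> R) (a b : R) : 0 <= p ->
  delay_caseC p tau -> 0 <= a -> a <= b -> tau b - tau a <= (1 + p) * (b - a).
Proof.
move=> p0 [ac der der1] a0 ab; apply: upper_abs_continuous_le => //.
- by lra.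
(* The horizon must be positive while [b] may be 0. *)
- move=> e e0; have [|d d0 Hd] := ac (b + 1) _ e e0; first lra.
  exists d => // m u v uv; apply: Hd => i im; have [? [? ?]] := uv i im.
  by split; [|split]; lra.
- case: der => N [mN N0 sub]; exists N; split => // t nt; apply: sub => /= H.
  by apply: nt => at'; apply: H; exact: le_trans a0 at'.
- case: der1 => N [mN N0 sub]; exists N; split => // t nt; apply: sub => /= H.
  by apply: nt => at'; apply: H; exact: le_trans a0 at'.
Qed.

End DelayOperator.

Theorem lemma1 (R : realType) (n : nat) (h mu p : R) (eta tau : R -> R)
    (hmu0 : 0 < mu) (hmuh : mu <= h) (hp : 0 <= p)
    (htau : forall t, tau t = h + eta t)
    (heta : forall t, 0 <= t -> `|eta t| <= mu)
    (hC : delay_caseC p tau)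
    (y : R -> 'cV[R[i]]_n) (hyL2 : in_L2 y) (hy0 : forall t, t <= 0 -> y t = 0) :
  (L2norm (u_of h mu p eta y) ^+ 2 <= L2norm y ^+ 2)%E.
Proof.
pose g (x : R) : R := if x < - h then mu else eta (x + h).
(* Being the largest admissible value, [mu] extends [g] to the left without
   violating the one-sided Lipschitz bound. *)
have gmu x : `|g x| <= mu.
  by rewrite /g; case: ltP => xh; [rewrite gtr0_norm|apply: heta; lra].
have gL : upper_lipschitz (1 + p) g.
  move=> a b ab; have h0 : 0 <= (1 + p) * (b - a) by apply: mulr_ge0; lra.
  rewrite /g; case: (ltP b (- h)) => bh.
    by rewrite (le_lt_trans ab bh) subrr.
  case: (ltP a (- h)) => ah.
    have : `|eta (b + h)| <= mu by apply: heta; lra.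
    by rewrite ler_norml => /andP[_ ?]; lra.
  have ab' : a + h <= b + h by rewrite lerD2r.
  have ah' : 0 <= a + h by lra.
  have := delay_upper_lipschitz hp hC ah' ab'; rewrite !htau.
  by rewrite (_ : b + h - (a + h) = b - a); [lra|ring].
(* The squared Euclidean norm is the sum of the squares of the real and imaginary parts, so the
   signal becomes a finite family of real functions. *)
pose f (k : 'I_n * bool) (s : R) : R :=
  if k.2 then complex.Re (y s k.1 0) else complex.Im (y s k.1 0).
have f0 k s : s <= 0 -> f k s = 0.
  by move=> s0; rewrite /f hy0// mxE; case: ifP.
(* Vanishing for [s <= 0] extends measurability from the half-line to the whole line. *)
have mf k : measurable_fun [set: R] (f k).
  have -> : f k = f k \_ `[0, +oo[.
    apply/funext => s; rewrite patchE; case: ifPn => //.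
    by rewrite notin_setE/= in_itv/= andbT => /negP; rewrite -ltNge => /ltW /f0.
  apply/(measurable_restrictT _ _).1 => //; case: hyL2 => /(_ k.1)[mRe mIm] _.
  by rewrite /f; case: k.2.
have fE s : \sum_k f k s ^+ 2 = euclid_norm (y s) ^+ 2.
  rewrite euclid_norm_sqr -(pair_bigA _ (fun k b => f (k, b) s ^+ 2))/=.
  by apply: eq_bigr => k _; rewrite big_bool.
have intE : (\int[@lebesgue_measure R]_s (\sum_k f k s ^+ 2)%:E = L2norm y ^+ 2)%E.
  rewrite L2norm_sqr [RHS]integral_mkcond; apply: eq_integral => s _.
  rewrite patchE fE; case: ifPn => //.
  rewrite notin_setE/= in_itv/= andbT => /negP; rewrite -ltNge => /ltW s0.
  by rewrite -fE big1// => k _; rewrite f0// expr0n.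
have fin : (\int[@lebesgue_measure R]_s (\sum_k f k s ^+ 2)%:E < +oo)%E.
  rewrite intE; case: hyL2 => _; have : (0 <= L2norm y)%E by exact: poweR_ge0.
  by case: (L2norm y) => // r _ _; rewrite -EFin_expe ltry.
have := delay_energy_le hmu0 hp gmu gL mf fin; rewrite intE.
have F0 := calF_gt0 hp.
have K0 : 0 < mu ^+ 2 * calF p by rewrite mulr_gt0// exprn_gt0.
pose S (x : R) : R := \sum_k (\int[@lebesgue_measure R]_(s in window g x) f k s) ^+ 2.
have S0 x : 0 <= S x by apply: sumr_ge0 => k _; exact: sqr_ge0.
have mS : measurable_fun [set: R] S.
  apply: measurable_sum => k; apply: measurable_funX.
  exact: (measurable_window_integral (measurable_upper_lipschitz gL)).
(* For [0 <= t] the point [t - h] lies where [g] comes from [eta], so the artificial values of [g]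
   do not enter [u]. *)
have uS t : 0 <= t -> euclid_norm (u_of h mu p eta y t) ^+ 2 =
    (mu ^+ 2 * calF p)^-1 * S (t - h).
  move=> t0; rewrite euclid_norm_u_of ?ltW//; congr (_ * _).
  rewrite /S -(pair_bigA _ (fun k b =>
    (\int[@lebesgue_measure R]_(s in window g (t - h)) f (k, b) s) ^+ 2))/=.
  have win (k : 'I_n * bool) : oriented_int (- h - eta t) (- h) (fun s => f k (t + s)) ^+ 2 =
      (\int[@lebesgue_measure R]_(s in window g (t - h)) f k s) ^+ 2.
    rewrite oriented_int_sqr; congr (_ ^+ 2).
    under eq_Rintegral do rewrite addrC.
    rewrite Rintegral_shift//; congr (Rintegral _ _ _).
    rewrite /window /g ltrBlDr addNr ltNge t0/= subrK addr_minl addr_maxl.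
    have -> : - h + t = t - h by ring.
    by have -> : - h - eta t + t = t - h - eta t by ring.
  by apply: eq_bigr => k _; rewrite big_bool/= -(win (k, true)) -(win (k, false)).
rewrite -lee_pdivrMl//; apply: le_trans.
rewrite L2norm_sqr -ge0_integralZl_EFin//; last 3 first.
- by move=> x _; rewrite lee_fin; exact: S0.
- by apply/measurable_EFinP; exact: mS.
- by rewrite invr_ge0 ltW.
rewrite -(@integral_shift _ (fun x => ((mu ^+ 2 * calF p)^-1)%:E * (S x)%:E)%E (- h)); last 2 first.
- by apply/measurable_EFinP; exact: measurable_funM.
- by move=> x; apply: mule_ge0; rewrite lee_fin ?S0// invr_ge0 ltW.
(* The energy of [u] counts [t >= 0] only; on the rest of the line the right side is nonnegative. *)
rewrite integral_mkcond; apply: integral_le_nonmeasurable => t _.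
  by rewrite patchE; case: ifP => // _; rewrite lee_fin sqr_ge0.
rewrite patchE; case: ifPn => [|_].
  by rewrite mem_setE in_itv/= andbT => t0; rewrite uS// EFinM.
by apply: mule_ge0; rewrite lee_fin ?S0// invr_ge0 ltW.
Qed.
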